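(* Let $\mathcal{A}$ be the (compact normal) operator of multiplication by the independent variable $z$ in $H=L^2(\nu)$, $\nu=\sum_n\nu_n\delta_{s_n}$ (not necessarily in $\mathfrak{S}_p$ for some $p>0$), let $t_n=s_n^{-1}$ and let $a=(a_n),b=(b_n)\in L^2(\nu)$. Assume that $\mathcal{L}=\mathcal{A}+a\otimes b$ is complete and that there exists $N\in\mathbb{N}_0$ such that $$\sum_n\frac{|b_n|^2}{|a_n|^2|t_n|^{2N}}<\infty$$ (where $a_n\neq 0$ for all $n$). Then $\dim\,(\mathcal{E}(\mathcal{L}^* ))^\perp\le N$. If, moreover, $a\notin zL^2(\nu)$, then $\mathcal{L}^*$ is complete.
   Context: Setting: $\{s_n\}\subset\mathbb{C}\setminus\{0\}$ is an infinite sequence of distinct points with $s_n\to0$, $\nu_n>0$, and $\nu=\sum_n\nu_n\delta_{s_n}$ is a finite measure; multiplication by $z$ in $L^2(\nu)$ is a cyclic compact normal operator with simple point spectrum $\{s_n\}$. Elements $a\in L^2(\nu)$ are identified with sequences $a=(a_n)$, $a_n=a(s_n)$. The rank one perturbation is $\mathcal{L}x=\mathcal{A}x+(x,b)a$, $x\in H$. $\mathbb{N}_0=\{0,1,2,\dots\}$. For a bounded operator $\mathcal{U}$, generalized eigenvectors are elements of $\ker(\mathcal{U}-\lambda I)^m$, $\lambda\in\mathbb{C}$, $m\in\mathbb{N}$; $\mathcal{E}(\mathcal{U})$ is the closed linear span of all generalized eigenvectors of $\mathcal{U}$, and $\mathcal{U}$ is called complete if $\mathcal{E}(\mathcal{U})=H$.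 $a\in zL^2(\nu)$ means $a\in\mathcal{A}H$, i.e. $\sum_n|a_n|^2|t_n|^2\nu_n<\infty$. *)

(* Defs.v *)
From HB Require Import structures.
From mathcomp Require Import all_boot all_order all_algebra.
From mathcomp Require Import all_classical all_reals all_analysis.
From mathcomp Require Import complex.

Set Implicit Arguments.
Unset Strict Implicit.
Unset Printing Implicit Defensive.

Import Order.TTheory GRing.Theory Num.Theory.
Import numFieldNormedType.Exports.

Local Open Scope classical_set_scope.
Local Open Scope ring_scope.
Local Open Scope complex_scope.

(* The sum of a complex series; R[i] carries no topology in the library, so the
   limit is taken on real and imaginary parts. *)
Definition csum (R : realType) (u : nat -> R[i]) : R[i] :=
  limn (series (fun n => complex.Re (u n))) +i*
  limn (series (fun n => complex.Im (u n))).

(* nu n is the mass of the atom s_n, and a function on {s_n} is identified with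
   the sequence of its values, so L^2(nu) is a set of sequences.  Operators on
   L^2(nu) are maps on all sequences, of which only the values on L2 nu matter. *)
Section L2.
Variables (R : realType) (nu : nat -> R).
Implicit Types (x y a b : nat -> R[i]) (S : set (nat -> R[i])).
Implicit Types U V : (nat -> R[i]) -> (nat -> R[i]).

Definition L2 : set (nat -> R[i]) :=
  [set x | cvgn (series (fun n => Normc.normc (x n) ^+ 2 * nu n))].

Definition l2norm x : R :=
  Num.sqrt (limn (series (fun n => Normc.normc (x n) ^+ 2 * nu n))).

Definition inner x y : R[i] := csum (fun n => x n * conjc (y n) * (nu n)%:C).

Definition is_adjoint U V : Prop :=
  (forall y, L2 y -> L2 (V y)) /\
  (forall x y, L2 x -> L2 y -> inner (U x) y = inner x (V y)).

Definition gen_eigenvector U : set (nat -> R[i]) :=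
  [set x | L2 x /\ exists (lambda : R[i]) (m : nat),
     iter m (fun y => U y - lambda *: y) x = 0].

Definition lin_span S : set (nat -> R[i]) :=
  [set x | exists (k : nat) (c : 'I_k -> R[i]) (v : 'I_k -> (nat -> R[i])),
     (forall i, S (v i)) /\ x = \sum_(i < k) c i *: v i].

Definition closed_lin_span S : set (nat -> R[i]) :=
  [set x | L2 x /\ forall eps : R, 0 < eps ->
     exists2 y, lin_span S y & L2 (x - y) /\ l2norm (x - y) < eps].

(* The space E(U). *)
Definition root_space U : set (nat -> R[i]) :=
  closed_lin_span (gen_eigenvector U).

Definition complete_op U : Prop := root_space U = L2.

Definition orth_compl S : set (nat -> R[i]) :=
  [set x | L2 x /\ forall y, S y -> inner x y = 0].

Definition mul_op (s : nat -> R[i]) x : nat -> R[i] := fun n => s n * x n.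

(* a \otimes b : x |-> (x, b) a *)
Definition rank_one a b x : nat -> R[i] := inner x b *: a.

Definition perturbed_op (s : nat -> R[i]) a b x : nat -> R[i] :=
  mul_op s x + rank_one a b x.

End L2.

(* S is spanned by N vectors; for a linear subspace S, this is dim S <= N. *)
Definition dim_le (R : realType) (S : set (nat -> R[i])) (N : nat) : Prop :=
  exists e : 'I_N -> (nat -> R[i]),
    S = [set x | exists c : 'I_N -> R[i], x = \sum_(i < N) c i *: e i].

(* Main.v *)
Require Import Defs.
From mathcomp Require Import all_boot all_order all_algebra.
From mathcomp Require Import all_classical all_reals all_analysis.
From mathcomp Require Import complex.
From mathcomp Require Import ring lra.

Import Order.TTheory GRing.Theory Num.Theory.
Import numFieldNormedType.Exports.

(** Write [P x = s x + (x, b) a] and let [sbar] be the conjugate of [s].  Testing the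
    adjoint relation against point masses shows that the adjoint is
    [Q y = sbar y + (y, a) b], of the same form with [a] and [b] exchanged.  Let [M]
    be the orthogonal complement of the root vectors of [Q].

    The antilinear map [transfer f = b * conj (f / a)] formally intertwines the two
    operators: [transfer (P f) = Q (transfer f)].  It need not preserve L2, but the
    hypothesis on [a] and [b] says that [sbar ^ N * transfer f] is in L2 for every [f]
    in L2; and since [Q - sbar] has range spanned by [b],
    [sbar ^ N * transfer f = transfer (P ^ N f) + p(sbar) b] with [p] a polynomial of
    degree less than [N] ([pow_transfer]).  So [transfer (P ^ N f)] is in L2 as well,
    and it is a root vector of [Q] whenever [f] is a root vector of [P].

    Let [y] in [M] satisfy the [N] linear conditions [(y, sbar ^ j b) = 0], [j < N].
    Then [y] is orthogonal to [sbar ^ N * transfer f] for all root vectors [f] of [P],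
    which is the same as [sbar ^ N * transfer y] being orthogonal to [f].  As [P] is
    complete, [transfer y = 0], that is, [y b = 0] ([orth_roots_annihilates]).  This
    forces [y = 0] ([orth_roots_eq0_of_mul]), so the [N] functionals are jointly
    injective on [M] and [dim M <= N].

    For the second claim, [M] is finite-dimensional and invariant under [P].  If it is
    not zero, it contains an eigenvector of [P].  For a nonzero eigenvalue this is
    impossible ([orth_roots_eigenvector_eq0]); for the eigenvalue [0] it reads
    [s y = - (y, b) a], which puts [a] in the range of multiplication by [s].  So
    [M = 0], and the projection theorem in L2 gives completeness of [Q].

    Both impossibility results come from one observation.  With [r = 1 / (sbar - mu)],
    the vectors [r ^ j b] satisfy [(Q - mu) (r ^ (j + 1) b) = r ^ j b + c_j b]; an
    element of [M] of the wrong kind forces all these vectors to be root vectors, and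
    fixes the moments [sum_n r_n ^ j b_n conj(a_n) nu_n] to be [-1] for [j = 1] and
    [0] for [j > 1].  But a summable sequence of masses at distinct points that
    converge to a point outside the sequence is determined by its moments
    ([moments_eq0]). *)

Set Implicit Arguments.
Unset Strict Implicit.
Unset Printing Implicit Defensive.

Local Open Scope classical_set_scope.
Local Open Scope ring_scope.

Local Notation normc := Normc.normc.
Local Notation "z %:C" := (z%:C)%C (format "z %:C") : ring_scope.

(** * The modulus of a complex number *)

Section Modulus.
Variable R : realType.
Implicit Types (z w : R[i]%C) (t : R).

Lemma normc_ge0 z : 0 <= normc z.
Proof. by case: z => x y; rewrite /= sqrtr_ge0. Qed.

Lemma normc_eq0 z : (normc z == 0) = (z == 0).
Proof.
apply/eqP/eqP => [/Normc.eq0_normc//|->]; exact: Normc.normc0.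
Qed.

Lemma normc_conj z : normc (conjc z) = normc z.
Proof. by case: z => x y; rewrite /= sqrrN. Qed.

Lemma normcR t : normc t%:C = `|t|.
Proof. by rewrite /= expr0n addr0 sqrtr_sqr. Qed.

Lemma normcX z n : normc (z ^+ n) = normc z ^+ n.
Proof.
elim: n => [|n IH]; first by rewrite !expr0 Normc.normc1.
by rewrite !exprS Normc.normcM IH.
Qed.

Lemma sqr_normcE z : normc z ^+ 2 = complex.Re z ^+ 2 + complex.Im z ^+ 2.
Proof. by case: z => x y; rewrite /= sqr_sqrtr ?addr_ge0 ?sqr_ge0. Qed.

Lemma mul_conj_normc z : z * conjc z = (normc z ^+ 2)%:C.
Proof.
case: z => x y; rewrite sqr_normcE /= /real_complex_def.
by apply/eqP; rewrite eq_complex /=; apply/andP; split; apply/eqP; ring.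
Qed.

Lemma Re_le_normc z : `|complex.Re z| <= normc z.
Proof.
rewrite -(ler_pXn2r (_ : 0 < 2)%N) ?nnegrE ?normc_ge0//.
by rewrite sqr_normcE real_normK ?num_real// lerDl sqr_ge0.
Qed.

Lemma Im_le_normc z : `|complex.Im z| <= normc z.
Proof.
rewrite -(ler_pXn2r (_ : 0 < 2)%N) ?nnegrE ?normc_ge0//.
by rewrite sqr_normcE real_normK ?num_real// lerDr sqr_ge0.
Qed.

Lemma ReB z w : complex.Re (z - w) = complex.Re z - complex.Re w.
Proof. by case: z; case: w. Qed.

Lemma ImB z w : complex.Im (z - w) = complex.Im z - complex.Im w.
Proof. by case: z; case: w. Qed.

Lemma conjcM z w : conjc (z * w) = conjc z * conjc w.
Proof. exact: rmorphM. Qed.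

Lemma conjcD z w : conjc (z + w) = conjc z + conjc w.
Proof. exact: rmorphD. Qed.

Lemma conjcN z : conjc (- z) = - conjc z.
Proof. exact: rmorphN. Qed.

Lemma realCM (t t' : R) : (t * t')%:C = t%:C * t'%:C :> R[i]%C.
Proof. exact: (rmorphM (real_complex R)). Qed.

Lemma conj_realC t : conjc t%:C = t%:C :> R[i]%C.
Proof. exact: conjc_real. Qed.

End Modulus.

(** * Absolutely summable complex sequences *)

Section Summable.
Variable R : realType.
Implicit Types (u v : nat -> R[i]%C) (c z : R[i]%C).

Definition asummable u := cvgn (series (fun n => normc (u n))).

Definition bounded_seq u := exists C : R, forall n, normc (u n) <= C.

Lemma asummable_le u (v : nat -> R) :
  (forall n, normc (u n) <= v n) -> cvgn (series v) -> asummable u.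
Proof.
move=> uv; apply: series_le_cvg => // n; first exact: normc_ge0.
by rewrite (le_trans _ (uv n)) ?normc_ge0.
Qed.

Lemma asummable_bounded u v :
  bounded_seq u -> asummable v -> asummable (fun n => u n * v n).
Proof.
move=> [C uC] sv; apply: (@asummable_le _ (C *: (fun n => normc (v n)))).
  by move=> n; rewrite Normc.normcM ler_wpM2r ?normc_ge0.
exact: is_cvg_seriesZ.
Qed.

Lemma asummableZ c u : asummable u -> asummable (fun n => c * u n).
Proof. by apply: asummable_bounded; exists (normc c). Qed.

Lemma asummable_Re u : asummable u -> cvgn (series (fun n => complex.Re (u n))).
Proof.
move=> su; apply: normed_cvg; apply: series_le_cvg su => n //=; first exact: normc_ge0.
exact: Re_le_normc.
Qed.

Lemma asummable_Im u : asummable u -> cvgn (series (fun n => complex.Im (u n))).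
Proof.
move=> su; apply: normed_cvg; apply: series_le_cvg su => n //=; first exact: normc_ge0.
exact: Im_le_normc.
Qed.

Lemma eq_lim_series (f g : nat -> R) : f =1 g ->
  limn (series f) = limn (series g).
Proof. by move/funext => ->. Qed.

Lemma csum0 : csum (fun=> 0 : R[i]%C) = 0.
Proof.
have E : series (fun=> 0 : R) = (fun=> 0).
  by apply/funext => n; rewrite /series /= big1.
by rewrite /csum /= E !lim_cst.
Qed.

Lemma csumD u v : asummable u -> asummable v ->
  csum (fun n => u n + v n) = csum u + csum v.
Proof.
move=> su sv; apply/eqP; rewrite eq_complex /=; apply/andP; split; apply/eqP.
  rewrite -(lim_seriesD (asummable_Re su) (asummable_Re sv)).
  by apply: eq_lim_series => n /=; rewrite ?fctE; case: (u n); case: (v n).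
rewrite -(lim_seriesD (asummable_Im su) (asummable_Im sv)).
by apply: eq_lim_series => n /=; rewrite ?fctE; case: (u n); case: (v n).
Qed.

Lemma csumZ c u : asummable u -> csum (fun n => c * u n) = c * csum u.
Proof.
move=> su; have sR := asummable_Re su; have sI := asummable_Im su.
case: c => x y; apply/eqP; rewrite eq_complex /=; apply/andP; split; apply/eqP.
  rewrite -[x * _]/(x *: _) -[y * _]/(y *: _) -!lim_seriesZ//.
  rewrite -lim_seriesB; [|exact: is_cvg_seriesZ..].
  by apply: eq_lim_series => n /=; rewrite ?fctE; case: (u n).
rewrite -[x * _]/(x *: _) -[y * _]/(y *: _) -!lim_seriesZ//.
rewrite -lim_seriesD; [|exact: is_cvg_seriesZ..].
by apply: eq_lim_series => n /=; rewrite ?fctE; case: (u n).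
Qed.

Lemma csum_conj u : asummable u -> csum (fun n => conjc (u n)) = conjc (csum u).
Proof.
move=> su; have sI := asummable_Im su.
apply/eqP; rewrite eq_complex /=; apply/andP; split; apply/eqP.
  by apply: eq_lim_series => n /=; rewrite ?fctE; case: (u n).
rewrite -lim_seriesN//.
by apply: eq_lim_series => n /=; rewrite ?fctE; case: (u n).
Qed.

Lemma csum_real (v : nat -> R) : csum (fun n => (v n)%:C) = (limn (series v))%:C.
Proof. by rewrite /csum /=; congr (_ +i* _)%C; have [] := csum0. Qed.

(** Rotating the sum onto the positive axis reduces the bound to real parts. *)
Lemma normc_csum_le u (v : nat -> R) : (forall n, normc (u n) <= v n) ->
  cvgn (series v) -> normc (csum u) <= limn (series v).
Proof.
move=> uv cv; have su := asummable_le uv cv.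
move E: (csum u) => S; have [->|S0] := eqVneq S 0.
  rewrite Normc.normc0; apply: limr_ge => //; near=> n.
  by apply: sumr_ge0 => i _; rewrite (le_trans _ (uv i)) ?normc_ge0.
have nS : 0 < normc S by rewrite lt_neqAle normc_ge0 eq_sym normc_eq0 S0.
rewrite -(ler_pM2l nS) -expr2.
have -> : normc S ^+ 2 = complex.Re (csum (fun n => conjc S * u n)).
  by rewrite csumZ// E mulrC mul_conj_normc.
rewrite /= -[normc S * _]/(normc S *: _) -lim_seriesZ//.
apply: lim_series_le.
- by apply: asummable_Re; apply: asummableZ.
- exact: is_cvg_seriesZ.
- move=> n; apply: (le_trans (ler_norm _)); apply: (le_trans (Re_le_normc _)).
  by rewrite Normc.normcM normc_conj ler_wpM2l ?normc_ge0.
Unshelve. all: by end_near. Qed.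

Lemma asummable_single k c : asummable (fun n => if n == k then c else 0).
Proof.
rewrite /asummable; apply: nondecreasing_is_cvgn.
  by apply: nondecreasing_series => n _ _; exact: normc_ge0.
exists (normc c) => _ [n _ <-]; rewrite /series /=.
rewrite (eq_bigr (fun i => if i == k then normc c else 0)); last first.
  by move=> i _; case: eqP => // _; rewrite Normc.normc0.
case: (ltnP k n) => kn.
  rewrite (bigD1_seq k) ?mem_index_iota ?iota_uniq//= eqxx big1 ?addr0//.
  by move=> i /negPf ->.
rewrite big_seq_cond big1 ?normc_ge0// => i /andP[].
by rewrite mem_index_iota => /andP[_]; case: eqP => // ->; rewrite ltnNge kn.
Qed.

Lemma csum_single k c : csum (fun n => if n == k then c else 0) = c.
Proof.
have lim_single (t : R) : limn (series (fun n => if n == k then t else 0)) = t.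
  apply/cvg_lim => //; apply: cvg_near_cst; near=> n.
  have kn : (k < n)%N by near: n; exact: nbhs_infty_gt.
  rewrite /series /= (bigD1_seq k) ?mem_index_iota ?iota_uniq//= eqxx.
  by rewrite big1 ?addr0// => i /negPf ->.
apply/eqP; rewrite eq_complex /=; apply/andP; split; apply/eqP.
  rewrite -[RHS](lim_single (complex.Re c)).
  by apply: eq_lim_series => n; case: eqP.
rewrite -[RHS](lim_single (complex.Im c)).
by apply: eq_lim_series => n; case: eqP.
Unshelve. all: by end_near. Qed.

End Summable.

(** * Moments of a summable sequence *)

Section Moments.
Variable R : realType.
Implicit Types (u v q x : nat -> R[i]%C) (c z : R[i]%C).

Lemma bounded_seq_cst c : bounded_seq (fun=> c).
Proof. by exists (normc c). Qed.

Lemma bounded_seqD u v : bounded_seq u -> bounded_seq v ->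
  bounded_seq (fun n => u n + v n).
Proof.
move=> [C uC] [D vD]; exists (C + D) => n.
by apply: (le_trans (le_normcD _ _)); apply: lerD.
Qed.

Lemma bounded_seqM u v : bounded_seq u -> bounded_seq v ->
  bounded_seq (fun n => u n * v n).
Proof.
move=> [C uC] [D vD]; exists (C * D) => n.
by rewrite Normc.normcM ler_pM ?normc_ge0.
Qed.

Lemma bounded_seqX u j : bounded_seq u -> bounded_seq (fun n => u n ^+ j).
Proof.
move=> bu; elim: j => [|j IH].
  by under eq_fun do rewrite expr0; exact: bounded_seq_cst.
by under eq_fun do rewrite exprS; exact: bounded_seqM.
Qed.

Lemma bounded_seq_conj u : bounded_seq u -> bounded_seq (fun n => conjc (u n)).
Proof. by move=> [C uC]; exists C => n; rewrite normc_conj. Qed.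

Lemma bounded_seq_horner (P : {poly R[i]%C}) u :
  bounded_seq u -> bounded_seq (fun n => P.[u n]).
Proof.
move=> bu; elim/poly_ind: P => [|P c IH].
  by under eq_fun do rewrite horner0; exact: bounded_seq_cst.
under eq_fun do rewrite hornerMXaddC.
by apply: bounded_seqD; [exact: bounded_seqM|exact: bounded_seq_cst].
Qed.

Lemma bounded_seq_cvg0 u : normc (u n) @[n --> \oo] --> (0 : R) -> bounded_seq u.
Proof.
move=> u0; have /cvg_seq_bounded : cvgn (fun n => normc (u n)) by apply/cvg_ex; exists 0.
move=> /bounded_fun_has_ubound[M uM]; exists M => n.
by apply: uM; exists n.
Qed.

Lemma asummableMb u v : asummable u -> bounded_seq v -> asummable (fun n => u n * v n).
Proof.
by move=> su bv; under eq_fun do rewrite mulrC; exact: asummable_bounded.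
Qed.

Lemma csum_splitE u k : asummable u ->
  csum u = u k + csum (fun n => if n == k then 0 else u n).
Proof.
move=> su; rewrite -[X in X + _](csum_single k (u k)) -csumD.
- congr (csum _); apply/funext => n; case: eqP => [->|_]; last by rewrite add0r.
  by rewrite addr0.
- exact: asummable_single.
- apply: asummable_le su => n; case: eqP => // _.
  by rewrite Normc.normc0 normc_ge0.
Qed.

(** Multiplying by a power of [x] makes the statement inductive in [P]. *)
Lemma csum_horner_eq0 q x (P : {poly R[i]%C}) : asummable q -> bounded_seq x ->
  (forall j, csum (fun n => q n * x n ^+ j) = 0) ->
  csum (fun n => q n * P.[x n]) = 0.
Proof.
move=> sq bx qx.
suff H j : csum (fun n => q n * (x n ^+ j * P.[x n])) = 0.
  by rewrite -[RHS](H 0); congr (csum _); apply/funext => n; rewrite expr0 mul1r.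
elim/poly_ind: P j => [|P c IH] j.
  by under eq_fun do rewrite horner0 !mulr0; rewrite csum0.
rewrite [X in csum X](_ : _ = (fun n => q n * (x n ^+ j.+1 * P.[x n]) +
    c * (q n * x n ^+ j))); last first.
  by apply/funext => n; rewrite hornerMXaddC exprS; ring.
have sj : asummable (fun n => q n * x n ^+ j) by apply: asummableMb => //; exact: bounded_seqX.
rewrite csumD ?csumZ ?IH ?qx ?mulr0 ?addr0//; last exact: asummableZ.
apply: asummableMb => //; apply: bounded_seqM; first exact: bounded_seqX.
exact: bounded_seq_horner.
Qed.

Lemma geometric_bound_le0 (A T : R) : (forall j, A <= T * 2^-1 ^+ j) -> A <= 0.
Proof.
move=> AT; have c0 : geometric T (2^-1 : R) @ \oo --> (0 : R).
  by apply: cvg_geometric; rewrite ger0_norm ?invr_ge0// invf_lt1// ltr1n.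
rewrite -(cvg_lim _ c0)//; apply: limr_ge; first by apply/cvg_ex; exists 0.
by near=> j; exact: AT.
Unshelve. all: by end_near. Qed.

(** All but finitely many points are at most half as far from [x0] as [x k].  A
    polynomial that vanishes at the others, except [x k], and to a high order at [x0]
    singles out the mass [q k]. *)
Lemma moments_eq0 q x (x0 : R[i]%C) : asummable q -> injective x ->
  normc (x n - x0) @[n --> \oo] --> (0 : R) -> (forall n, x n != x0) ->
  (forall j, csum (fun n => q n * x n ^+ j) = 0) -> forall n, q n = 0.
Proof.
move=> sq x_inj xx0 x_neq mom k.
have bx : bounded_seq x.
  rewrite (_ : x = fun n => (x n - x0) + x0); last by apply/funext => n; rewrite subrK.
  by apply: bounded_seqD; [exact: bounded_seq_cvg0|exact: bounded_seq_cst].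
set rho := normc (x k - x0).
have rho0 : 0 < rho by rewrite lt_neqAle normc_ge0 eq_sym normc_eq0 subr_eq0 x_neq.
have [K xK] : exists K, forall n, (K <= n)%N -> normc (x n - x0) <= rho / 2.
  have /cvgrPdist_le/(_ (rho / 2)) := xx0; rewrite divr_gt0// => /(_ isT).
  move=> [K _ xK]; exists K => n Kn; have := xK n Kn.
  by rewrite /= sub0r normrN ger0_norm// normc_ge0.
pose W : {poly R[i]%C} := \prod_(m <- iota 0 K | m != k) ('X - (x m)%:P).
have Wk : W.[x k] != 0.
  rewrite horner_prod prodf_seq_neq0; apply/allP => m _; apply/implyP => mk.
  by rewrite hornerXsubC subr_eq0 (inj_eq x_inj) eq_sym.
have W0 n : (n < K)%N -> n != k -> W.[x n] = 0.
  move=> nK nk; apply/eqP; rewrite horner_prod prodf_seq_eq0; apply/hasP.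
  by exists n; rewrite ?mem_iota// nk hornerXsubC subrr eqxx.
have sW : asummable (fun n => q n * W.[x n]).
  by apply: asummableMb => //; exact: bounded_seq_horner.
pose T := limn (series (fun n => normc (q n * W.[x n]))).
suff : normc (q k * W.[x k]) <= 0.
  rewrite le_eqVlt ltNge normc_ge0 orbF normc_eq0 mulf_eq0 (negPf Wk) orbF.
  by move/eqP.
apply: (@geometric_bound_le0 _ T) => j.
have := csum_horner_eq0 (('X - x0%:P) ^+ j * W) sq bx mom.
rewrite (csum_splitE k); last first.
  by apply: asummableMb => //; exact: bounded_seq_horner.
set tail := csum _ => /eqP; rewrite addr_eq0 => /eqP tailE.
rewrite -(ler_pM2r (exprn_gt0 j rho0)).
have -> : normc (q k * W.[x k]) * rho ^+ j = normc tail.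
  rewrite -[RHS]normcN -tailE hornerM horner_exp hornerXsubC /rho -normcX -Normc.normcM.
  by congr normc; ring.
have -> : T * 2^-1 ^+ j * rho ^+ j =
    limn (series ((rho / 2) ^+ j *: (fun n => normc (q n * W.[x n])))).
  by rewrite lim_seriesZ// exprMn -[RHS]/(_ * _) /T; ring.
apply: normc_csum_le; last exact: is_cvg_seriesZ.
move=> n; rewrite fctE -[X in _ <= X]/(_ * _).
have r2 : 0 <= (rho / 2) ^+ j by rewrite exprn_ge0// divr_ge0// ltW.
case: eqP => [_|/eqP nk]; first by rewrite Normc.normc0 mulr_ge0 ?normc_ge0.
rewrite hornerM horner_exp hornerXsubC mulrCA Normc.normcM normcX.
case: (ltnP n K) => nK; first by rewrite W0// mulr0 Normc.normc0 !mulr0.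
by rewrite ler_wpM2r ?normc_ge0// lerXn2r ?nnegrE ?normc_ge0 ?xK// divr_ge0// ltW.
Qed.

End Moments.

(** * The space L2(nu) *)

Section WeightedL2.
Variables (R : realType) (nu : nat -> R).
Hypothesis nu_gt0 : forall n, 0 < nu n.
Implicit Types (x y z u v : nat -> R[i]%C) (c : R[i]%C) (S : set (nat -> R[i]%C)).

Definition sqnorm x : R := limn (series (fun n => normc (x n) ^+ 2 * nu n)).

Definition single (k : nat) c : nat -> R[i]%C := fun n => if n == k then c else 0.

Lemma sqnorm_term_ge0 x n : 0 <= normc (x n) ^+ 2 * nu n.
Proof. by rewrite mulr_ge0 ?sqr_ge0// ltW. Qed.

Lemma L2_dominated (C : R) x y : (forall n, normc (x n) <= C * normc (y n)) ->
  L2 nu y -> L2 nu x.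
Proof.
move=> xy Ly; rewrite /L2 /=.
apply: (@series_le_cvg _ _ (C ^+ 2 *: (fun n => normc (y n) ^+ 2 * nu n))).
- exact: sqnorm_term_ge0.
- by move=> n; rewrite fctE -[X in _ <= X]/(_ * _) mulr_ge0 ?sqr_ge0 ?sqnorm_term_ge0.
- move=> n; rewrite fctE -[X in _ <= X]/(_ * _) mulrA ler_wpM2r//; first exact: ltW.
  by rewrite -exprMn lerXn2r ?nnegrE ?normc_ge0// (le_trans _ (xy n)) ?normc_ge0.
- exact: is_cvg_seriesZ.
Qed.

Lemma L2D x y : L2 nu x -> L2 nu y -> L2 nu (x + y).
Proof.
move=> Lx Ly; rewrite /L2 /=.
apply: (@series_le_cvg _ _ (2 *: ((fun n => normc (x n) ^+ 2 * nu n) +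
   (fun n => normc (y n) ^+ 2 * nu n)))).
- exact: sqnorm_term_ge0.
- by move=> n; rewrite !fctE -[X in _ <= X]/(_ * _) mulr_ge0// addr_ge0 ?sqnorm_term_ge0.
- move=> n; rewrite !fctE -[X in _ <= X]/(_ * _) -mulrDl mulrA ler_wpM2r//; first exact: ltW.
  have := le_normcD (x n) (y n); have := normc_ge0 (x n + y n).
  move: (normc (x n + y n)) (normc (x n)) (normc (y n)) => p q r p0 pqr.
  have : p ^+ 2 <= (q + r) ^+ 2 by rewrite lerXn2r ?nnegrE// (le_trans p0 pqr).
  by move/le_trans; apply; have := sqr_ge0 (q - r); rewrite -subr_ge0 => H; nra.
- by apply: is_cvg_seriesZ; exact: is_cvg_seriesD.
Qed.

Lemma L2_bounded u x : bounded_seq u -> L2 nu x -> L2 nu (fun n => u n * x n).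
Proof.
move=> [C uC]; apply: L2_dominated => n.
by rewrite Normc.normcM ler_wpM2r ?normc_ge0 ?uC.
Qed.

Lemma L2Z c x : L2 nu x -> L2 nu (c *: x).
Proof. exact: (L2_bounded (bounded_seq_cst c)). Qed.

Lemma L2N x : L2 nu x -> L2 nu (- x).
Proof. by rewrite -scaleN1r; exact: L2Z. Qed.

Lemma L2B x y : L2 nu x -> L2 nu y -> L2 nu (x - y).
Proof. by move=> Lx Ly; apply: L2D => //; exact: L2N. Qed.

Lemma L2_single k c : L2 nu (single k c).
Proof.
rewrite /L2 /= (_ : (fun n => _) =
  (fun n => normc (if n == k then (normc c ^+ 2 * nu k)%:C else 0))).
  exact: asummable_single.
apply/funext => n; rewrite /single; case: eqP => [->|_].
  by rewrite normcR ger0_norm// mulr_ge0 ?sqr_ge0// ltW.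
by rewrite !Normc.normc0 expr0n mul0r.
Qed.

Lemma single0 k : single k 0 = 0.
Proof. by apply/funext => n; rewrite /single if_same. Qed.

Lemma L2_0 : L2 nu 0.
Proof. by rewrite -(single0 0); exact: L2_single. Qed.

Lemma L2_sum k (F : 'I_k -> nat -> R[i]%C) : (forall i, L2 nu (F i)) ->
  L2 nu (\sum_(i < k) F i).
Proof.
by move=> LF; elim/big_ind: _ => // [|x y]; [exact: L2_0|exact: L2D].
Qed.

Lemma asummable_inner x y : L2 nu x -> L2 nu y ->
  asummable (fun n => x n * conjc (y n) * (nu n)%:C).
Proof.
move=> Lx Ly; apply: (@asummable_le _ _ ((fun n => normc (x n) ^+ 2 * nu n) +
   (fun n => normc (y n) ^+ 2 * nu n))); last exact: is_cvg_seriesD.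
move=> n; rewrite fctE !Normc.normcM normc_conj normcR gtr0_norm// -mulrDl.
rewrite ler_wpM2r//; first exact: ltW.
move: (normc (x n)) (normc (y n)) (normc_ge0 (x n)) (normc_ge0 (y n)) => p q p0 q0.
by have := sqr_ge0 (p - q); rewrite -subr_ge0 => H; nra.
Qed.

Lemma innerDl x y z : L2 nu x -> L2 nu y -> L2 nu z ->
  inner nu (x + y) z = inner nu x z + inner nu y z.
Proof.
move=> Lx Ly Lz; rewrite /inner -csumD; [|exact: asummable_inner..].
by congr csum; apply/funext => n; rewrite fctE; ring.
Qed.

Lemma innerZl c x z : L2 nu x -> L2 nu z ->
  inner nu (c *: x) z = c * inner nu x z.
Proof.
move=> Lx Lz; rewrite /inner -csumZ; last exact: asummable_inner.
by congr csum; apply/funext => n; rewrite fctE -[c *: _]/(_ * _); ring.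
Qed.

Lemma inner_conj x y : L2 nu x -> L2 nu y -> conjc (inner nu x y) = inner nu y x.
Proof.
move=> Lx Ly; rewrite /inner -csum_conj; last exact: asummable_inner.
by congr csum; apply/funext => n; rewrite !conjcM conjcK conj_realC; ring.
Qed.

Lemma innerDr x y z : L2 nu x -> L2 nu y -> L2 nu z ->
  inner nu x (y + z) = inner nu x y + inner nu x z.
Proof.
move=> Lx Ly Lz; have Lyz := L2D Ly Lz.
by rewrite -!(inner_conj (y := x))// innerDl// conjcD.
Qed.

Lemma innerZr c x y : L2 nu x -> L2 nu y ->
  inner nu x (c *: y) = conjc c * inner nu x y.
Proof.
move=> Lx Ly; have Lcy : L2 nu (c *: y) by exact: L2Z.
by rewrite -!(inner_conj (y := x))// innerZl// conjcM.
Qed.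

Lemma innerNl x y : L2 nu x -> L2 nu y -> inner nu (- x) y = - inner nu x y.
Proof. by move=> Lx Ly; rewrite -scaleN1r innerZl// mulN1r. Qed.

Lemma innerNr x y : L2 nu x -> L2 nu y -> inner nu x (- y) = - inner nu x y.
Proof. by move=> Lx Ly; rewrite -scaleN1r innerZr// conjcN conjc1 mulN1r. Qed.

Lemma innerBl x y z : L2 nu x -> L2 nu y -> L2 nu z ->
  inner nu (x - y) z = inner nu x z - inner nu y z.
Proof. by move=> Lx Ly Lz; rewrite innerDl ?innerNl//; exact: L2N. Qed.

Lemma innerBr x y z : L2 nu x -> L2 nu y -> L2 nu z ->
  inner nu x (y - z) = inner nu x y - inner nu x z.
Proof. by move=> Lx Ly Lz; rewrite innerDr ?innerNr//; exact: L2N. Qed.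

Lemma inner_singlel k c y : inner nu (single k c) y = c * conjc (y k) * (nu k)%:C.
Proof.
rewrite /inner -[RHS](csum_single k); congr csum; apply/funext => n.
by rewrite /single; case: eqP => [->//|_]; rewrite !mul0r.
Qed.

Lemma inner_singler k c x : inner nu x (single k c) = x k * conjc c * (nu k)%:C.
Proof.
rewrite /inner -[RHS](csum_single k); congr csum; apply/funext => n.
by rewrite /single; case: eqP => [->//|_]; rewrite conjc0 mulr0 mul0r.
Qed.

Lemma inner0l y : inner nu 0 y = 0.
Proof. by rewrite -(single0 0) inner_singlel !mul0r. Qed.

Lemma inner_suml k (F : 'I_k -> nat -> R[i]%C) y : (forall i, L2 nu (F i)) ->
  L2 nu y -> inner nu (\sum_(i < k) F i) y = \sum_(i < k) inner nu (F i) y.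
Proof.
move=> LF Ly; suff : L2 nu (\sum_(i < k) F i) /\
  inner nu (\sum_(i < k) F i) y = \sum_(i < k) inner nu (F i) y by case.
elim/big_rec2: _ => [|i c x _ [Lx <-]].
  by rewrite inner0l; split=> //; exact: L2_0.
by rewrite innerDl//; split=> //; exact: L2D.
Qed.

Lemma inner_self x : inner nu x x = (sqnorm x)%:C.
Proof.
rewrite /inner /sqnorm -csum_real; congr csum; apply/funext => n.
by rewrite mul_conj_normc -realCM.
Qed.

Lemma sqnorm_partial_le x m : L2 nu x ->
  \sum_(0 <= n < m) normc (x n) ^+ 2 * nu n <= sqnorm x.
Proof.
move=> Lx; apply: (nondecreasing_cvgn_le _ Lx).
by apply: nondecreasing_series => n _ _; exact: sqnorm_term_ge0.
Qed.

Lemma coord_le_sqnorm x n : L2 nu x -> normc (x n) ^+ 2 * nu n <= sqnorm x.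
Proof.
move=> Lx; apply: le_trans (sqnorm_partial_le n.+1 Lx).
by rewrite big_nat_recr//= lerDr sumr_ge0// => i _; exact: sqnorm_term_ge0.
Qed.

Lemma sqnorm_ge0 x : L2 nu x -> 0 <= sqnorm x.
Proof. by move=> Lx; exact: le_trans (sqnorm_term_ge0 x 0) (coord_le_sqnorm 0 Lx). Qed.

Lemma sqnorm_le0 x : L2 nu x -> sqnorm x <= 0 -> x = 0.
Proof.
move=> Lx x0; apply/funext => n; apply/eqP; rewrite -normc_eq0 -sqrf_eq0.
have := le_trans (coord_le_sqnorm n Lx) x0; rewrite pmulr_lle0// => H.
by rewrite eq_le H sqr_ge0.
Qed.

Lemma sqnormB x y : L2 nu x -> L2 nu y ->
  sqnorm (x - y) = sqnorm x - 2 * complex.Re (inner nu x y) + sqnorm y.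
Proof.
move=> Lx Ly; have Lxy := L2B Lx Ly.
have E : (sqnorm (x - y))%:C = inner nu (x - y) (x - y) by rewrite inner_self.
rewrite innerBl// !innerBr// !inner_self -(inner_conj Lx Ly) in E.
move: E; case: (inner nu x y) => p q /= [-> _]; ring.
Qed.

Lemma sqnormZ c x : L2 nu x -> sqnorm (c *: x) = normc c ^+ 2 * sqnorm x.
Proof.
move=> Lx; rewrite /sqnorm -[RHS]/(_ *: _) -lim_seriesZ//.
apply: eq_lim_series => n; rewrite !fctE -[c *: _]/(_ * _) Normc.normcM exprMn.
by rewrite -mulrA.
Qed.

Lemma sqnormN x : sqnorm (- x) = sqnorm x.
Proof. by apply: eq_lim_series => n; rewrite fctE normcN. Qed.

Lemma l2norm_sqr x : L2 nu x -> l2norm nu x ^+ 2 = sqnorm x.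
Proof. by move=> Lx; rewrite /l2norm sqr_sqrtr// sqnorm_ge0. Qed.

(** If no multiple of [v] approximates [u] much better than [0] does, then [u] is
    nearly orthogonal to [v]; with [e = sqnorm u] this is the Cauchy-Schwarz
    inequality. *)
Lemma near_minimal_inner (e : R) u v : L2 nu u -> L2 nu v ->
  (forall c, sqnorm u - e <= sqnorm (u - c *: v)) ->
  normc (inner nu u v) ^+ 2 <= e * sqnorm v.
Proof.
move=> Lu Lv H; have [v0|v0] := leP (sqnorm v) 0.
  have -> : v = 0 by exact: sqnorm_le0.
  have L0 := L2_0; rewrite -inner_conj// inner0l conjc0 Normc.normc0 expr0n.
  rewrite mulr_ge0 ?sqnorm_ge0//.
  have := H 0; rewrite scale0r subr0 => {}H; lra.
have := H ((sqnorm v)^-1%:C * inner nu u v).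
rewrite sqnormB//; last exact: L2Z.
rewrite innerZr// sqnormZ// Normc.normcM normcR gtr0_norm ?invr_gt0// conjcM.
rewrite conj_realC -mulrA [conjc _ * _]mulrC mul_conj_normc -realCM.
rewrite -[complex.Re _]/(_ * _).
move: (normc _) (sqnorm v) v0 => n q q0 {}H.
rewrite -ler_pdivrMr//; move: H; rewrite exprMn expr2 -[_ * q]mulrA.
rewrite -[_ * _ * (_ * q)]mulrA [_ ^+ 2 * q]mulrC mulKf ?gt_eqF//; lra.
Qed.

End WeightedL2.

(** * Completeness and orthogonality *)

Section Hilbert.
Variables (R : realType) (nu : nat -> R).
Hypothesis nu_gt0 : forall n, 0 < nu n.
Implicit Types (x y z u v : nat -> R[i]%C) (c : R[i]%C) (S : set (nat -> R[i]%C)).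

Lemma sqnorm0 : sqnorm nu 0 = 0.
Proof. by apply: complexI; rewrite -inner_self inner0l. Qed.

Lemma cauchy_schwarz u v : L2 nu u -> L2 nu v ->
  normc (inner nu u v) ^+ 2 <= sqnorm nu u * sqnorm nu v.
Proof.
move=> Lu Lv; apply: near_minimal_inner => // c; rewrite subrr.
by apply: sqnorm_ge0 => //; apply: L2B => //; exact: L2Z.
Qed.

Lemma cvg_sqr_cauchy (f d : nat -> R) : d @ \oo --> (0 : R) ->
  (forall j k, (k <= j)%N -> (f j - f k) ^+ 2 <= d k) -> cvgn f.
Proof.
move=> d0 fd; apply/cauchy_cvgP; apply: cauchy_exP => e e0 /=.
have /cvgrPdist_lt/(_ (e ^+ 2)) := d0; rewrite exprn_gt0// => /(_ isT) [k _ /(_ k)].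
rewrite /= leqnn sub0r normrN => /(_ isT) dk.
exists (f k), k => // j /= kj; rewrite -ball_normE /= -(ltr_pXn2r (n := 2))//.
- rewrite distrC real_normK ?num_real//; apply: le_lt_trans (fd _ _ kj) _.
  exact: le_lt_trans (ler_norm _) dk.
- by rewrite nnegrE ltW.
Qed.

(** The coordinates converge because each of them is controlled by the norm; the
    bound on the distance to the limit is first obtained for finitely many coordinates,
    where the limit can be taken term by term. *)
Lemma L2_complete (u : nat -> nat -> R[i]%C) (d : nat -> R) :
  (forall k, L2 nu (u k)) -> d @ \oo --> (0 : R) ->
  (forall j k, (k <= j)%N -> sqnorm nu (u j - u k) <= d k) ->
  exists z, L2 nu z /\ forall k, sqnorm nu (z - u k) <= d k.
Proof.
move=> Lu d0 ud.
have ud1 n j k : (k <= j)%N -> normc (u j n - u k n) ^+ 2 <= d k / nu n.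
  move=> kj; rewrite ler_pdivlMr//; apply: le_trans (ud _ _ kj).
  by apply: (coord_le_sqnorm nu_gt0 (x := u j - u k)); exact: L2B.
have dn n : (fun k => d k / nu n) @ \oo --> (0 : R).
  by rewrite -[X in _ --> X](mul0r (nu n)^-1); apply: cvgMl.
have cR n : cvgn (fun j => complex.Re (u j n)).
  apply: (cvg_sqr_cauchy (dn n)) => j k kj; apply: le_trans (ud1 n _ _ kj).
  by rewrite sqr_normcE ReB ImB lerDl sqr_ge0.
have cI n : cvgn (fun j => complex.Im (u j n)).
  apply: (cvg_sqr_cauchy (dn n)) => j k kj; apply: le_trans (ud1 n _ _ kj).
  by rewrite sqr_normcE ReB ImB lerDr sqr_ge0.
pose z n : R[i]%C := (limn (fun j => complex.Re (u j n)) +i* limn (fun j => complex.Im (u j n)))%C.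
have zn n k : (fun j => normc (u j n - u k n) ^+ 2) @ \oo --> normc (z n - u k n) ^+ 2.
  under eq_fun do rewrite sqr_normcE ReB ImB.
  rewrite sqr_normcE ReB ImB.
  have sq (f : nat -> R) (l t : R) : f @ \oo --> l ->
      (fun j => (f j - t) ^+ 2) @ \oo --> (l - t) ^+ 2.
    move=> fl; have ft : (fun j => f j - t) @ \oo --> l - t.
      by apply: cvgB => //; exact: cvg_cst.
    by rewrite expr2; under eq_fun do rewrite expr2; exact: cvgM.
  by apply: cvgD; apply: sq; [exact: cR|exact: cI].
have zsum k m : \sum_(0 <= n < m) normc ((z - u k) n) ^+ 2 * nu n <= d k.
  have c : (fun j => \sum_(0 <= n < m) normc ((u j - u k) n) ^+ 2 * nu n) @ \oo -->
      \sum_(0 <= n < m) normc ((z - u k) n) ^+ 2 * nu n.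
    elim: m => [|m IH].
      by under eq_fun do rewrite big_nil; rewrite big_nil; exact: cvg_cst.
    under eq_fun do rewrite big_nat_recr//=; rewrite big_nat_recr//=.
    by apply: cvgD => //; apply: cvgMl; exact: zn.
  rewrite -(cvg_lim _ c)//; apply: limr_le; first by apply/cvg_ex; eexists; exact: c.
  near=> j; apply: (le_trans (sqnorm_partial_le nu_gt0 _ _)); first exact: L2B.
  by apply: ud; near: j; exact: nbhs_infty_ge.
have Lzk k : L2 nu (z - u k).
  apply: nondecreasing_is_cvgn.
    by apply: nondecreasing_series => n _ _; exact: sqnorm_term_ge0.
  by exists (d k) => _ [m _ <-]; exact: zsum.
exists z; split; first by rewrite -(subrK (u 0%N) z); exact: L2D.
move=> k; apply: limr_le; first exact: Lzk.
by near=> m; exact: zsum.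
Unshelve. all: by end_near. Qed.

Lemma lin_span_incl S x : S x -> lin_span S x.
Proof.
move=> Sx; exists 1%N, (fun=> 1), (fun=> x); split=> //.
by rewrite big_ord1 scale1r.
Qed.

Lemma lin_span0 S : lin_span S 0.
Proof.
by exists 0%N, (fun=> 0), (fun=> 0); split=> [[]//|]; rewrite big_ord0.
Qed.

Lemma lin_spanZ S c x : lin_span S x -> lin_span S (c *: x).
Proof.
move=> [k [d [v [Sv ->]]]]; exists k, (fun i => c * d i), v; split=> //.
by rewrite scaler_sumr; apply: eq_bigr => i _; rewrite scalerA.
Qed.

Lemma lin_spanD S x y : lin_span S x -> lin_span S y -> lin_span S (x + y).
Proof.
move=> [k [d [v [Sv ->]]]] [l [e [w [Sw ->]]]].
exists (k + l)%N, (fun i => match fintype.split i with inl i => d i | inr i => e i end),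
  (fun i => match fintype.split i with inl i => v i | inr i => w i end); split.
  by move=> i; case: fintype.split.
rewrite big_split_ord /=; congr (_ + _); apply: eq_bigr => i _.
  by rewrite -[lshift _ _]/(unsplit (inl i)) unsplitK.
by rewrite -[rshift _ _]/(unsplit (inr i)) unsplitK.
Qed.

Lemma lin_spanB S x y : lin_span S x -> lin_span S y -> lin_span S (x - y).
Proof. by move=> Sx Sy; apply: lin_spanD => //; rewrite -scaleN1r; exact: lin_spanZ. Qed.

Lemma lin_span_L2 S : S `<=` L2 nu -> lin_span S `<=` L2 nu.
Proof.
move=> SL x [k [d [v [Sv ->]]]]; apply: L2_sum => // i.
by apply: L2Z => //; exact: SL.
Qed.

Lemma orth_lin_span S x : S `<=` L2 nu -> L2 nu x ->
  (forall y, S y -> inner nu y x = 0) -> forall y, lin_span S y -> inner nu y x = 0.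
Proof.
move=> SL Lx Sx y [k [d [v [Sv ->]]]]; have Lv i : L2 nu (v i) by exact: SL.
rewrite inner_suml//; last by move=> i; exact: L2Z.
by rewrite big1// => i _; rewrite innerZl// Sx// mulr0.
Qed.

Lemma inner_eq0C x y : L2 nu x -> L2 nu y -> inner nu x y = 0 -> inner nu y x = 0.
Proof. by move=> Lx Ly xy; rewrite -inner_conj// xy conjc0. Qed.

(** A limit passage in the form in which the definition of the closed span uses it. *)
Lemma eps_sqr_le0 (t M : R) : 0 <= M ->
  (forall eps : R, 0 < eps -> t <= eps ^+ 2 * M) -> t <= 0.
Proof.
move=> M0 H; rewrite leNgt; apply/negP => t0.
have M1 : 0 < M + 1 by rewrite ltr_pwDr.
have e0 : 0 < t / (M + 1) by rewrite divr_gt0.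
have := H (Num.sqrt (t / (M + 1))); rewrite sqrtr_gt0 => /(_ e0).
rewrite sqr_sqrtr ?(ltW e0)// mulrAC ler_pdivlMr//; nra.
Qed.

Lemma orth_closed_lin_span S x y : S `<=` L2 nu -> L2 nu x ->
  (forall y, S y -> inner nu y x = 0) -> closed_lin_span nu S y -> inner nu y x = 0.
Proof.
move=> SL Lx Sx [Ly yS]; apply/eqP; rewrite -normc_eq0 -sqrf_eq0 eq_le sqr_ge0 andbT.
apply: (@eps_sqr_le0 _ (sqnorm nu x)); first exact: sqnorm_ge0.
move=> eps e0; have [w Sw [Lyw yw]] := yS _ e0.
have Lw := lin_span_L2 SL Sw.
rewrite -[inner nu y x]subr0 -(orth_lin_span SL Lx Sx Sw) -innerBl//.
apply: (le_trans (cauchy_schwarz Lyw Lx)); rewrite ler_wpM2r ?sqnorm_ge0//.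
by rewrite -l2norm_sqr// lerXn2r ?nnegrE ?sqrtr_ge0 ?ltW.
Qed.

Lemma orth_compl_closed_lin_span S : S `<=` L2 nu ->
  orth_compl nu (closed_lin_span nu S) = orth_compl nu S.
Proof.
move=> SL; apply/seteqP; split=> x [Lx xS]; split=> // y Sy.
  apply: xS; split; first exact: SL.
  move=> eps e0; exists y; first exact: lin_span_incl.
  rewrite subrr; split; first exact: L2_0.
  by rewrite /l2norm -[limn _]/(sqnorm nu 0) sqnorm0 sqrtr0.
apply: inner_eq0C => //; first by case: Sy.
apply: (orth_closed_lin_span SL) => // z Sz.
by apply: inner_eq0C (xS _ Sz) => //; exact: SL.
Qed.

End Hilbert.

(** * The projection theorem *)

Section Projection.
Variables (R : realType) (nu : nat -> R).
Hypothesis nu_gt0 : forall n, 0 < nu n.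
Implicit Types (x y z u v : nat -> R[i]%C) (c : R[i]%C) (S : set (nat -> R[i]%C)).

Lemma harmonic_bound_le0 (t M : R) : (forall k, t <= M * harmonic k) -> t <= 0.
Proof.
move=> H; have c : (fun k => M * harmonic k) @ \oo --> (0 : R).
  by rewrite -[X in _ --> X](mulr0 M); apply: cvgMr; exact: cvg_harmonic.
rewrite -(cvg_lim _ c)//; apply: limr_ge; first by apply/cvg_ex; exists 0.
by near=> j; exact: H.
Unshelve. all: by end_near. Qed.

(** The residuals of a minimizing sequence for the distance of [x] to the span
    converge to a vector orthogonal to the span. *)
Lemma exists_orth S x : S `<=` L2 nu -> L2 nu x -> ~ closed_lin_span nu S x ->
  exists2 z, orth_compl nu S z & z <> 0.
Proof.
move=> SL Lx xS.
have [eps e0 far] : exists2 eps : R, 0 < eps &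
    forall y, lin_span S y -> eps ^+ 2 <= sqnorm nu (x - y).
  (* The negation of membership in the closed span gives a uniform distance. *)
  apply: contrapT => no; apply: xS; split=> // eps e0.
  apply: contrapT => noy; apply: no; exists eps => // y Sy.
  have Lxy : L2 nu (x - y) by apply: L2B => //; exact: lin_span_L2 Sy.
  rewrite leNgt; apply/negP => xy; apply: noy; exists y => //; split=> //.
  by rewrite -(ltr_pXn2r (n := 2)) ?nnegrE ?sqrtr_ge0 ?(ltW e0)// l2norm_sqr.
pose E := [set sqnorm nu (x - y) | y in lin_span S].
have Einf : has_inf E.
  split; first by exists (sqnorm nu (x - 0)), 0 => //; exact: lin_span0.
  by exists (eps ^+ 2) => _ [y Sy <-]; exact: far.
have near_inf k : exists y, lin_span S y /\ sqnorm nu (x - y) < inf E + harmonic k.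
  have [_ [y Sy <-] yE] := inf_adherent (harmonic_gt0 k) Einf.
  by exists y.
have [y yP] := choice near_inf.
pose u k := x - y k.
have Lspan v : lin_span S v -> L2 nu v by exact: lin_span_L2.
have Lu k : L2 nu (u k) by apply: L2B => //; apply: Lspan; have [] := yP k.
have uv k v : lin_span S v ->
    normc (inner nu (u k) v) ^+ 2 <= harmonic k * sqnorm nu v.
  move=> Sv; have [Sy yE] := yP k.
  apply: near_minimal_inner => //; first exact: Lspan.
  move=> c; rewrite lerBlDr; apply: le_trans (ltW yE) _; rewrite lerD2r.
  apply: ge_inf; first by case: Einf.
  exists (y k + c *: v); last by rewrite /u opprD addrA.
  by apply: lin_spanD => //; exact: lin_spanZ.
have hle j k : (k <= j)%N -> (harmonic j : R) <= harmonic k.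
  by move=> kj; rewrite /harmonic /= lef_pV2 ?posrE// ler_nat.
(* The difference [v] of two residuals lies in the span, and both residuals are
   nearly orthogonal to it. *)
have cauchy_u j k : (k <= j)%N -> sqnorm nu (u j - u k) <= 4 * harmonic k.
  move=> kj; set v := u j - u k.
  have Sv : lin_span S v.
    have -> : v = y k - y j by rewrite /v /u opprB addrACA [X in _ + X]addrC addrACA subrr add0r addrC.
    by apply: lin_spanB; [have [] := yP k|have [] := yP j].
  have Lv := Lspan _ Sv.
  have vE : (sqnorm nu v)%:C = inner nu (u j) v - inner nu (u k) v.
    by rewrite -inner_self -innerBl.
  have vle : sqnorm nu v <= normc (inner nu (u j) v) + normc (inner nu (u k) v).
    rewrite -(normcN (inner nu (u k) v)); apply: le_trans (le_normcD _ _).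
    by rewrite -vE normcR ler_norm.
  have := uv j v Sv; have := uv k v Sv; have := sqnorm_ge0 nu_gt0 Lv.
  have : 0 <= harmonic k :> R by exact: harmonic_ge0.
  have := hle _ _ kj; move: vle (normc_ge0 (inner nu (u j) v)) (normc_ge0 (inner nu (u k) v)).
  move: (normc (inner nu (u j) v) : R) (normc (inner nu (u k) v) : R).
  move: (sqnorm nu v) (harmonic j : R) (harmonic k : R).
  move=> q hj hk p1 p2 qp p10 p20 hjk hk0 q0 H2 H1.
  have [->|qn] := eqVneq q 0; first by rewrite mulr_ge0.
  have qp0 : 0 < q by rewrite lt_neqAle eq_sym qn.
  have q2 : q * q <= 4 * hk * q.
    have h1 : hj * q <= hk * q by rewrite ler_wpM2r.
    have h2 : q * q <= (p1 + p2) * (p1 + p2) by apply: ler_pM.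
    have h3 := sqr_ge0 (p1 - p2); nra.
  by rewrite ler_pM2r in q2.
have [] := L2_complete nu_gt0 Lu (d := fun k => 4 * harmonic k) _ cauchy_u.
  by rewrite -[X in _ --> X](mulr0 4); apply: cvgMr; exact: cvg_harmonic.
move=> z [Lz zu]; exists z; last first.
  move=> z0; have : eps ^+ 2 <= 0; last by rewrite leNgt exprn_gt0.
  apply: (@harmonic_bound_le0 _ 4) => k; apply: le_trans (zu k).
  by rewrite z0 sub0r sqnormN; apply: far; have [] := yP k.
split=> // v Sv; have Lv := SL _ Sv; apply/eqP.
rewrite -normc_eq0 -sqrf_eq0 eq_le sqr_ge0 andbT.
apply: (@harmonic_bound_le0 _ (10 * sqnorm nu v)) => k.
have zE : inner nu z v = inner nu (z - u k) v + inner nu (u k) v.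
  by rewrite -innerDl ?subrK//; exact: L2B.
have := le_normcD (inner nu (z - u k) v) (inner nu (u k) v); rewrite -zE.
have := uv k v (lin_span_incl Sv).
have := cauchy_schwarz nu_gt0 (L2B nu_gt0 Lz (Lu k)) Lv.
have := zu k; have := sqnorm_ge0 nu_gt0 Lv.
have := normc_ge0 (inner nu z v).
move: (normc (inner nu z v) : R) (normc (inner nu (z - u k) v) : R).
move: (normc (inner nu (u k) v) : R) (sqnorm nu (z - u k)).
move: (sqnorm nu v) (harmonic k : R) => q h p2 w p p1 p0 q0 wh H1 H2 pp.
have h1 : w * q <= 4 * h * q by rewrite ler_wpM2r.
have h2 : p ^+ 2 <= (p1 + p2) ^+ 2 by rewrite lerXn2r ?nnegrE// (le_trans p0 pp).
by have := sqr_ge0 (p1 - p2); nra.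
Qed.

Lemma closed_lin_span_full S : S `<=` L2 nu ->
  (forall z, orth_compl nu S z -> z = 0) -> closed_lin_span nu S = L2 nu.
Proof.
move=> SL S0; apply/seteqP; split=> x; first by case.
move=> Lx; apply: contrapT => /(exists_orth SL Lx)[z Sz]; apply.
exact: S0.
Qed.

End Projection.

(** * Root vectors of a rank one perturbation *)

Section Perturbation.
Variables (R : realType) (nu : nat -> R).
Hypothesis nu_gt0 : forall n, 0 < nu n.
Variables (s a b : nat -> R[i]%C).
Hypotheses (s_bounded : bounded_seq s) (a_L2 : L2 nu a) (b_L2 : L2 nu b).
Implicit Types (x y f g : nat -> R[i]%C) (c lambda : R[i]%C).

Local Notation P := (perturbed_op nu s a b).

Definition spectral_shift (U : (nat -> R[i]%C) -> (nat -> R[i]%C)) lambda y := U y - lambda *: y.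

Lemma perturbed_opE x n : P x n = s n * x n + inner nu x b * a n.
Proof. by []. Qed.

Lemma L2_perturbed x : L2 nu x -> L2 nu (P x).
Proof.
by move=> Lx; apply: L2D => //; [exact: L2_bounded|exact: L2Z].
Qed.

Lemma perturbedD x y : L2 nu x -> L2 nu y -> P (x + y) = P x + P y.
Proof.
move=> Lx Ly; apply/funext => n.
rewrite -[RHS]/(P x n + P y n) !perturbed_opE innerDl//.
by rewrite -[(x + y) n]/(x n + y n); ring.
Qed.

Lemma perturbedZ c x : L2 nu x -> P (c *: x) = c *: P x.
Proof.
move=> Lx; apply/funext => n.
rewrite -[RHS]/(c * P x n) !perturbed_opE innerZl//.
by rewrite -[(c *: x) n]/(c * x n); ring.
Qed.

Lemma perturbed_sum k (c : 'I_k -> R[i]%C) (v : 'I_k -> nat -> R[i]%C) :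
  (forall i, L2 nu (v i)) -> P (\sum_(i < k) c i *: v i) = \sum_(i < k) c i *: P (v i).
Proof.
move=> Lv; suff : L2 nu (\sum_(i < k) c i *: v i) /\
  P (\sum_(i < k) c i *: v i) = \sum_(i < k) c i *: P (v i) by case.
have L0 : L2 nu 0 by exact: L2_0.
elim/big_rec2: _ => [|i w x _ [Lx <-]].
  by split=> //; rewrite -(scale0r (0 : nat -> R[i]%C)) perturbedZ// !scale0r.
have Lcv : L2 nu (c i *: v i) by exact: L2Z.
by split; [exact: L2D|rewrite perturbedD// perturbedZ].
Qed.

Lemma L2_iter_perturbed n x : L2 nu x -> L2 nu (iter n P x).
Proof. by move=> Lx; elim: n => //= n; exact: L2_perturbed. Qed.

Lemma L2_shift lambda x : L2 nu x -> L2 nu (spectral_shift P lambda x).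
Proof.
by move=> Lx; apply: L2B => //; [exact: L2_perturbed|exact: L2Z].
Qed.

Lemma L2_iter_shift n lambda x : L2 nu x -> L2 nu (iter n (spectral_shift P lambda) x).
Proof. by move=> Lx; elim: n => //= n; exact: L2_shift. Qed.

Lemma perturbed_shift lambda x : L2 nu x ->
  P (spectral_shift P lambda x) = spectral_shift P lambda (P x).
Proof.
move=> Lx; have LPx := L2_perturbed Lx; have Llx : L2 nu ((- lambda) *: x) by exact: L2Z.
by rewrite /spectral_shift -!scaleNr perturbedD// perturbedZ.
Qed.

Lemma perturbed_iter_shift m lambda x : L2 nu x ->
  P (iter m (spectral_shift P lambda) x) = iter m (spectral_shift P lambda) (P x).
Proof.
move=> Lx; elim: m => //= m <-; rewrite perturbed_shift//.
exact: L2_iter_shift.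
Qed.

Lemma iter_perturbed_iter_shift n m lambda x : L2 nu x ->
  iter n P (iter m (spectral_shift P lambda) x) = iter m (spectral_shift P lambda) (iter n P x).
Proof.
move=> Lx; elim: n => //= n ->; rewrite perturbed_iter_shift//.
exact: L2_iter_perturbed.
Qed.

Lemma perturbed0 : P 0 = 0.
Proof.
by rewrite -(scale0r (0 : nat -> R[i]%C)) perturbedZ ?scale0r//; exact: L2_0.
Qed.

Definition root_vector lambda : set (nat -> R[i]%C) :=
  [set x | L2 nu x /\ exists m, iter m (spectral_shift P lambda) x = 0].

Lemma gen_eigenvectorE : gen_eigenvector nu P = \bigcup_lambda root_vector lambda.
Proof.
apply/seteqP; split=> x.
  by move=> [Lx [lambda [m xm]]]; exists lambda => //; split=> //; exists m.
by move=> [lambda _ [Lx [m xm]]]; split=> //; exists lambda, m.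
Qed.

Lemma root_vector0 lambda : root_vector lambda 0.
Proof. by split; [exact: L2_0|exists 0%N]. Qed.

Lemma root_vector_shift lambda x : L2 nu x ->
  root_vector lambda (spectral_shift P lambda x) -> root_vector lambda x.
Proof. by move=> Lx [_ [m xm]]; split=> //; exists m.+1; rewrite iterSr. Qed.

Lemma gen_eigenvector_L2 : gen_eigenvector nu P `<=` L2 nu.
Proof. by move=> x []. Qed.

Lemma gen_eigenvector_perturbed x :
  gen_eigenvector nu P x -> gen_eigenvector nu P (P x).
Proof.
rewrite gen_eigenvectorE => -[lambda _ [Lx [m xm]]]; exists lambda => //.
split; first exact: L2_perturbed.
by exists m; rewrite -perturbed_iter_shift// xm perturbed0.
Qed.

End Perturbation.

Definition conj_seq (R : realType) (s : nat -> R[i]%C) n := conjc (s n).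

(** The coordinates of [V y] are read off by pairing with point masses. *)
Lemma adjoint_perturbedE (R : realType) (nu : nat -> R) (s a b : nat -> R[i]%C)
    (V : (nat -> R[i]%C) -> (nat -> R[i]%C)) :
  (forall n, 0 < nu n) -> bounded_seq s -> L2 nu a -> L2 nu b ->
  is_adjoint nu (perturbed_op nu s a b) V ->
  forall y, L2 nu y -> V y = perturbed_op nu (conj_seq s) b a y.
Proof.
move=> nu_gt0 bs aL bL [VL adj] y Ly; apply/funext => n.
have Ld : L2 nu (single n 1) by exact: L2_single.
have nun : (nu n)%:C != 0 :> R[i]%C.
  by rewrite -[0]/(0%:C) (inj_eq (@complexI R)) gt_eqF.
apply: (can_inj (@conjcK R)); apply: (mulIf nun).
have := adj _ _ Ld Ly; rewrite inner_singlel mul1r => <-.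
rewrite /perturbed_op innerDl//; first last.
- by apply: L2Z.
- exact: L2_bounded.
rewrite innerZl// inner_singlel mul1r.
rewrite (_ : mul_op s (single n 1) = single n (s n)); last first.
  by apply/funext => k; rewrite /mul_op /single; case: eqP => [->|_]; rewrite ?mulr1 ?mulr0.
rewrite inner_singlel fctE conjcD conjcM conjcK -[rank_one _ _ _ _ _]/(inner nu y a * b n).
by rewrite conjcM inner_conj//; ring.
Qed.

(** * Transfer of root vectors *)

Section Transfer.
Variables (R : realType) (nu : nat -> R).
Hypothesis nu_gt0 : forall n, 0 < nu n.
Variables (s a b : nat -> R[i]%C).
Hypotheses (s_bounded : bounded_seq s) (a_L2 : L2 nu a) (b_L2 : L2 nu b).
Hypothesis a_neq0 : forall n, a n != 0.
Implicit Types (x y f g : nat -> R[i]%C) (c lambda : R[i]%C).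

Local Notation P := (perturbed_op nu s a b).
Local Notation sbar := (conj_seq s).
Local Notation Q := (perturbed_op nu sbar b a).

(** The symmetry exchanging [P] and its adjoint.  The values need not be square
    summable, but the pairing with [a] converges for square summable [f]. *)
Definition transfer f n := b n * conjc (f n / a n).

Let abar_neq0 n : conjc (a n) != 0.
Proof. by rewrite conjc_eq0 a_neq0. Qed.

Lemma inner_transfer f : inner nu (transfer f) a = inner nu b f.
Proof.
rewrite /inner; congr csum; apply/funext => n; congr (_ * _).
by rewrite /transfer conjcM conjc_inv -mulrA mulfVK.
Qed.

Lemma transfer_perturbed f : L2 nu f -> transfer (P f) = Q (transfer f).
Proof.
move=> Lf; apply/funext => n; rewrite perturbed_opE inner_transfer.
rewrite /transfer perturbed_opE mulrDl !conjcM conjcD !conjcM inner_conj//.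
by rewrite conjc_inv -!mulrA mulfV// /conj_seq; ring.
Qed.

Lemma transfer_shift lambda f : L2 nu f ->
  transfer (spectral_shift P lambda f) = spectral_shift Q (conjc lambda) (transfer f).
Proof.
move=> Lf; apply/funext => n.
rewrite -[RHS]/(Q (transfer f) n - conjc lambda * transfer f n) -transfer_perturbed//.
rewrite /transfer -[spectral_shift P lambda f n]/(P f n - lambda * f n).
by rewrite mulrBl conjcD conjcN !conjcM; ring.
Qed.

Lemma transfer_iter_shift m lambda f : L2 nu f ->
  transfer (iter m (spectral_shift P lambda) f) = iter m (spectral_shift Q (conjc lambda)) (transfer f).
Proof.
move=> Lf; elim: m => //= m <-; rewrite transfer_shift//.
exact: L2_iter_shift.
Qed.

Lemma transfer0 : transfer 0 = 0.
Proof. by apply/funext => n; rewrite /transfer -[(0 : nat -> R[i]%C) n]/(0 : R[i]%C) mul0r conjc0 mulr0. Qed.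

(** Each application of [Q] differs from multiplication by [sbar] by a multiple of [b],
    so [n] of them leave a polynomial in [sbar] of degree less than [n] times [b]. *)
Lemma pow_transfer n f : L2 nu f -> exists2 p : {poly R[i]%C}, (size p <= n)%N &
  forall k, sbar k ^+ n * transfer f k = transfer (iter n P f) k + p.[sbar k] * b k.
Proof.
elim: n f => [|n IH] f Lf.
  by exists 0 => [|k]; rewrite ?size_poly0// expr0 mul1r horner0 mul0r addr0.
have LPf : L2 nu (P f) by exact: L2_perturbed.
have [p pn pE] := IH _ LPf.
exists (p - inner nu b f *: 'X^n).
  rewrite (leq_trans (size_polyD _ _))// geq_max (leq_trans pn)//=.
  by rewrite size_polyN (leq_trans (size_scale_leq _ _))// size_polyXn.
move=> k; rewrite iterSr hornerD hornerN hornerZ hornerXn mulrBl addrA -pE transfer_perturbed//.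
by rewrite perturbed_opE inner_transfer exprS; ring.
Qed.

Variable N : nat.
Hypothesis ab_sum : cvgn (series (fun n =>
  normc (b n) ^+ 2 / (normc (a n) ^+ 2 * normc (s n)^-1 ^+ (2 * N)))).

(** The masses [nu] enter only through the uniform bound
    [|f_n|^2 nu_n <= |f|^2]. *)
Lemma L2_pow_transfer f : L2 nu f -> L2 nu (fun n => sbar n ^+ N * transfer f n).
Proof.
move=> Lf; apply: (@series_le_cvg _ _ (sqnorm nu f *: (fun n =>
  normc (b n) ^+ 2 / (normc (a n) ^+ 2 * normc (s n)^-1 ^+ (2 * N))))).
- move=> n; exact: (sqnorm_term_ge0 nu_gt0 (fun n => sbar n ^+ N * transfer f n)).
- move=> n; rewrite fctE -[X in _ <= X]/(_ * _) mulr_ge0 ?sqnorm_ge0//.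
  by rewrite divr_ge0 ?sqr_ge0// mulr_ge0 ?sqr_ge0// exprn_ge0// normc_ge0.
- move=> n; rewrite fctE -[X in _ <= X]/(_ * _).
  have -> : normc (sbar n ^+ N * transfer f n) ^+ 2 * nu n =
    (normc (f n) ^+ 2 * nu n) *
    (normc (b n) ^+ 2 / (normc (a n) ^+ 2 * normc (s n)^-1 ^+ (2 * N))).
    rewrite /transfer !Normc.normcM !normc_conj Normc.normcM !Normc.normcV.
    rewrite normcX normc_conj exprVn invfM invrK mulnC exprM !exprMn exprVn.
    by ring.
  rewrite ler_wpM2r ?coord_le_sqnorm//.
  by rewrite divr_ge0 ?sqr_ge0// mulr_ge0 ?sqr_ge0// exprn_ge0// normc_ge0.
- exact: is_cvg_seriesZ.
Qed.

Lemma sbar_bounded : bounded_seq sbar.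
Proof. exact: bounded_seq_conj. Qed.

(** Both other terms of [pow_transfer] are in L2. *)
Lemma L2_transfer_iter f : L2 nu f -> L2 nu (transfer (iter N P f)).
Proof.
move=> Lf; have [p _ pE] := pow_transfer N Lf.
have -> : transfer (iter N P f) =
    (fun k => sbar k ^+ N * transfer f k) - (fun k => p.[sbar k] * b k).
  by apply/funext => k; rewrite fctE pE addrK.
apply: L2B => //; first exact: L2_pow_transfer.
apply: L2_bounded => //; apply: bounded_seq_horner; exact: sbar_bounded.
Qed.

Lemma gen_eigenvector_transfer f :
  gen_eigenvector nu P f -> gen_eigenvector nu Q (transfer (iter N P f)).
Proof.
rewrite gen_eigenvectorE => -[lambda _ [Lf [m fm]]].
rewrite gen_eigenvectorE; exists (conjc lambda) => //.
split; first exact: L2_transfer_iter.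
exists m; rewrite -transfer_iter_shift; last exact: L2_iter_perturbed.
rewrite -iter_perturbed_iter_shift// fm -[RHS]transfer0; congr transfer.
by elim: (N) => //= n ->; exact: perturbed0.
Qed.

Hypothesis s_neq0 : forall n, s n != 0.
Hypothesis P_complete : complete_op nu P.

Lemma orth_roots_complete w : orth_compl nu (gen_eigenvector nu P) w -> w = 0.
Proof.
rewrite -orth_compl_closed_lin_span//; last exact: gen_eigenvector_L2.
rewrite -/(root_space nu P) P_complete => -[Lw Sw].
apply: (sqnorm_le0 nu_gt0 Lw).
have /complexI -> // : (sqnorm nu w)%:C = 0%:C by rewrite -inner_self Sw.
Qed.

(** The form [(f, sbar ^ N * transfer y)] is symmetric in [f] and [y]; the conditions on
    [y] remove the polynomial term of [pow_transfer]. *)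
Lemma orth_roots_annihilates y : orth_compl nu (gen_eigenvector nu Q) y ->
  (forall j, (j < N)%N -> inner nu y (fun n => sbar n ^+ j * b n) = 0) ->
  forall n, y n * b n = 0.
Proof.
move=> [Ly Qy] yb n.
have Lsb j : L2 nu (fun n => sbar n ^+ j * b n).
  by apply: L2_bounded => //; apply: bounded_seqX; exact: sbar_bounded.
pose w k := sbar k ^+ N * transfer y k.
have Lw : L2 nu w by exact: L2_pow_transfer.
have w0 : w = 0.
  apply: orth_roots_complete; split=> // f Pf.
  have Lf : L2 nu f by case: Pf.
  apply: inner_eq0C => //.
  have -> : inner nu f w = inner nu y (fun k => sbar k ^+ N * transfer f k).
    rewrite /inner; congr csum; apply/funext => k; congr (_ * _).
    by rewrite /w /transfer !conjcM !conjcK; ring.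
  have [p pN pE] := pow_transfer N Lf.
  have -> : (fun k => sbar k ^+ N * transfer f k) = transfer (iter N P f) +
      \sum_(j < N) p`_j *: (fun k => sbar k ^+ j * b k).
    apply/funext => k; rewrite pE fctE; congr (_ + _).
    rewrite fct_sumE (horner_coef_wide _ pN) mulr_suml; apply: eq_bigr => j _.
    by rewrite -[RHS]/(_ * _) mulrA.
  have Lsum : L2 nu (\sum_(j < N) p`_j *: (fun k => sbar k ^+ j * b k)).
    by apply: L2_sum => // j; exact: L2Z.
  rewrite innerDr//; last exact: L2_transfer_iter.
  rewrite Qy ?add0r; last exact: gen_eigenvector_transfer.
  apply: inner_eq0C => //; rewrite inner_suml//; last by move=> j; exact: L2Z.
  rewrite big1// => j _; rewrite innerZl// (inner_eq0C _ Ly) ?mulr0//.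
  exact: yb.
have /eqP : w n = 0 by rewrite w0.
rewrite /w /transfer mulf_eq0 expf_eq0 conjc_eq0 (negPf (s_neq0 n)) andbF /=.
rewrite mulf_eq0 conjc_eq0 mulf_eq0 invr_eq0 (negPf (a_neq0 n)) orbF.
by case/orP => /eqP ->; rewrite ?mulr0 ?mul0r.
Qed.

End Transfer.

(** * Root subspaces at nonzero points *)

Section Chain.
Variables (R : realType) (nu : nat -> R).
Hypothesis nu_gt0 : forall n, 0 < nu n.
Variables (t a b : nat -> R[i]%C).
Hypotheses (a_L2 : L2 nu a) (b_L2 : L2 nu b).
Hypotheses (t_inj : injective t) (t_neq0 : forall n, t n != 0).
Hypothesis t_cvg0 : normc (t n) @[n --> \oo] --> (0 : R).
Variable mu : R[i]%C.
Hypothesis mu_neq0 : mu != 0.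
Implicit Types (x y h v : nat -> R[i]%C) (c tau : R[i]%C).

Local Notation Q := (perturbed_op nu t b a).

(** With the convention that the inverse of [0] is [0], this is also the resolvent
    of multiplication by [t] at an eigenvalue [t k], compressed to the complement of the [k]-th point mass. *)
Definition resolvent n := (t n - mu)^-1.

(** The candidates for a Jordan chain of [Q] at [mu]. *)
Definition chain j n := resolvent n ^+ j * b n.

Lemma resolvent_cvg : normc (resolvent n - - mu^-1) @[n --> \oo] --> (0 : R).
Proof.
have m0 : 0 < normc mu by rewrite lt_neqAle eq_sym normc_eq0 mu_neq0 normc_ge0.
have C0 : (fun n => 2 / normc mu ^+ 2 * normc (t n)) @ \oo --> (0 : R).
  by rewrite -[X in _ --> X](mulr0 (2 / normc mu ^+ 2)); exact: cvgMr.
apply: (squeeze_cvgr _ (cvg_cst 0) C0).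
near=> n; rewrite normc_ge0 /=.
have tn : normc (t n) <= normc mu / 2.
  near: n; have /cvgrPdist_le/(_ (normc mu / 2)) := t_cvg0.
  rewrite divr_gt0// => /(_ isT); apply: filterS => n.
  by rewrite /= sub0r normrN ger0_norm// normc_ge0.
have tm : normc mu / 2 <= normc (t n - mu).
  have := le_normcD (t n - mu) (- t n).
  by rewrite addrAC subrr add0r !normcN; lra.
have tm0 : t n - mu != 0.
  by rewrite -normc_eq0 gt_eqF// (lt_le_trans _ tm)// divr_gt0.
have -> : resolvent n - - mu^-1 = t n * ((t n - mu)^-1 * mu^-1).
  by rewrite /resolvent opprK; field; rewrite mu_neq0.
rewrite !Normc.normcM !Normc.normcV mulrC ler_wpM2r ?normc_ge0//.
rewrite expr2 invfM mulrA ler_wpM2r ?invr_ge0 ?normc_ge0//.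
rewrite -[2]invrK -invfM mulrC lef_pV2 ?posrE ?divr_gt0//.
by rewrite (lt_le_trans _ tm)// divr_gt0.
Unshelve. all: by end_near. Qed.

Lemma resolvent_bounded : bounded_seq resolvent.
Proof.
rewrite (_ : resolvent = fun n => (resolvent n - - mu^-1) + (- mu^-1)); last first.
  by apply/funext => n; rewrite subrK.
apply: bounded_seqD; last exact: bounded_seq_cst.
exact: bounded_seq_cvg0 resolvent_cvg.
Qed.

Lemma L2_chain j : L2 nu (chain j).
Proof.
by apply: L2_bounded => //; apply: bounded_seqX; exact: resolvent_bounded.
Qed.

(** From the second moment on, all moments of the masses [chain 2 * conj a * nu] at the
    points [resolvent n] vanish, so these masses vanish; but then so does the first
    moment. *)
Lemma chain_moments_contra :
  (forall j, inner nu (chain j.+1) a = (- (j == 0)%:R)) -> False.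
Proof.
move=> mom; have q0 : forall n, chain 2 n * conjc (a n) * (nu n)%:C = 0.
  apply: (@moments_eq0 _ _ resolvent (- mu^-1)).
  - by apply: asummable_inner => //; exact: L2_chain.
  - by move=> m n /invr_inj/addIr/t_inj.
  - exact: resolvent_cvg.
  - move=> n; rewrite -invrN (inj_eq invr_inj) -subr_eq0 opprK subrK.
    exact: t_neq0.
  - move=> j; have := mom j.+1; rewrite /= oppr0 => <-; rewrite /inner.
    congr csum; apply/funext => n; rewrite /chain -[in RHS]addn2 exprD; ring.
have := mom 0; rewrite /= /inner (_ : (fun n => _) = fun=> 0) ?csum0; last first.
  apply/funext => n; have [r0|r0] := eqVneq (resolvent n) 0.
    by rewrite /chain r0 expr1 !mul0r.
  by apply: (mulfI r0); rewrite mulr0 -[RHS](q0 n) /chain; ring.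
by move/eqP; rewrite eq_sym oppr_eq0 oner_eq0.
Qed.

(* Where [t n = mu] the resolvent is [0], so that [t - mu] inverts it only on
   sequences vanishing there. *)
Hypothesis b_eigen : forall n, t n = mu -> b n = 0.

Lemma chain0 : chain 0 = b.
Proof. by apply/funext => n; rewrite /chain expr0 mul1r. Qed.

Lemma shift_chain j :
  spectral_shift Q mu (chain j.+1) = chain j + inner nu (chain j.+1) a *: b.
Proof.
apply/funext => n.
rewrite -[LHS]/(t n * chain j.+1 n + inner nu (chain j.+1) a * b n - mu * chain j.+1 n).
rewrite -[RHS]/(chain j n + inner nu (chain j.+1) a * b n) addrAC; congr (_ + _).
rewrite -mulrBl /chain /resolvent; have [tm|tm] := eqVneq (t n) mu.
  by rewrite b_eigen// !mulr0.
by rewrite exprS !mulrA mulfV ?subr_eq0// mul1r.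
Qed.

(** [chain 0] is [b], in general not a root vector; starting from [0] instead adds [1]
    to the first defect below. *)
Definition chain_root j : nat -> R[i]%C := if j is 0 then 0 else chain j.

Definition chain_defect j : R[i]%C := inner nu (chain j.+1) a + (j == 0)%:R.

Lemma shift_chain_root j :
  spectral_shift Q mu (chain j.+1) = chain_root j + chain_defect j *: b.
Proof.
rewrite shift_chain /chain_defect scalerDl; case: j => [|j] /=.
  by rewrite chain0 scale1r add0r addrC.
by rewrite scale0r addr0.
Qed.

(** A vanishing defect makes the next vector of the chain a root vector, so the
    hypothesis propagates along the chain and yields the moments excluded by
    [chain_moments_contra]. *)
Lemma chain_contra :
  (forall j, root_vector nu t b a mu (chain_root j) -> chain_defect j = 0) -> False.
Proof.
move=> H; have bt : bounded_seq t by exact: bounded_seq_cvg0.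
have K j : root_vector nu t b a mu (chain_root j).
  elim: j => [|j IH]; first exact: root_vector0.
  apply: root_vector_shift => //; first exact: L2_chain.
  by rewrite shift_chain_root H// scale0r addr0.
apply: chain_moments_contra => j; apply/eqP; rewrite -subr_eq0 opprK.
by apply/eqP; exact: H.
Qed.

End Chain.

(** * Vectors orthogonal to all root vectors *)

Section OrthogonalToRoots.
Variables (R : realType) (nu : nat -> R).
Hypothesis nu_gt0 : forall n, 0 < nu n.
Variables (s a b : nat -> R[i]%C).
Hypotheses (a_L2 : L2 nu a) (b_L2 : L2 nu b) (a_neq0 : forall n, a n != 0).
Hypotheses (s_inj : injective s) (s_neq0 : forall n, s n != 0).
Hypothesis s_cvg0 : normc (s n) @[n --> \oo] --> (0 : R).
Implicit Types (x y : nat -> R[i]%C) (lambda : R[i]%C).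

Local Notation sbar := (conj_seq s).
Local Notation P := (perturbed_op nu s a b).
Local Notation Q := (perturbed_op nu sbar b a).

Let sbar_inj : injective sbar.
Proof. by move=> m n /(can_inj (@conjcK R))/s_inj. Qed.

Let sbar_neq0 n : sbar n != 0.
Proof. by rewrite conjc_eq0. Qed.

Let sbar_cvg0 : normc (sbar n) @[n --> \oo] --> (0 : R).
Proof. by under eq_fun do rewrite normc_conj. Qed.

Let sbar_bdd : bounded_seq sbar.
Proof. exact: bounded_seq_cvg0. Qed.

Lemma orth_root_vector mu y g : orth_compl nu (gen_eigenvector nu Q) y ->
  root_vector nu sbar b a mu g -> inner nu y g = 0.
Proof.
by move=> [_ Qy] g_root; apply: Qy; rewrite gen_eigenvectorE; exists mu.
Qed.

(** At [mu = conj (s k)] with [b k = 0] the point mass at [k] is sent to a multiple of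
    [b] and can absorb each defect of the chain; the corrected vector is a root
    vector, and orthogonality of [y] to it shows that the correction was zero. *)
Lemma orth_roots_eq0_of_mul y : orth_compl nu (gen_eigenvector nu Q) y ->
  (forall n, y n * b n = 0) -> y = 0.
Proof.
move=> yQ yb; have Ly : L2 nu y by case: yQ.
apply/funext => k; apply/eqP/negP => /negP yk.
have bk : b k = 0 by have /eqP := yb k; rewrite mulf_eq0 (negPf yk) => /eqP.
have b_eigen n : sbar n = sbar k -> b n = 0 by move/sbar_inj ->.
have nuk : (nu k)%:C != 0 :> R[i]%C.
  by rewrite -[0]/(0%:C) (inj_eq (@complexI R)) gt_eqF.
apply: (@chain_contra _ _ nu_gt0 sbar a b _ _ _ _ _ (sbar k)) => // j root_j.
set alpha := conjc (a k) * (nu k)%:C.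
have alpha0 : alpha != 0 by rewrite mulf_neq0// conjc_eq0.
set tau := chain_defect _ _ _ _ _ _; pose c := tau / alpha.
set e := chain sbar b (sbar k) j.+1.
have Le : L2 nu e by exact: L2_chain.
have Ld : L2 nu (single k c) by exact: L2_single.
have root_v : root_vector nu sbar b a (sbar k) (e - single k c).
  apply: root_vector_shift => //; first exact: L2B.
  suff -> : spectral_shift Q (sbar k) (e - single k c) = chain_root sbar b (sbar k) j by [].
  have -> : chain_root sbar b (sbar k) j = spectral_shift Q (sbar k) e - tau *: b.
    by rewrite shift_chain_root// addrK.
  apply/funext => n; rewrite -[LHS]/(sbar n * (e n - single k c n) +
    inner nu (e - single k c) a * b n - sbar k * (e n - single k c n)).
  rewrite -[RHS]/(sbar n * e n + inner nu e a * b n - sbar k * e n - tau * b n).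
  rewrite innerBl// inner_singlel -mulrA -/alpha /c divfK// /single.
  by case: eqP => [->|_]; ring.
have := orth_root_vector yQ root_v; rewrite innerBr// inner_singler.
have -> : inner nu y e = 0.
  rewrite -[RHS](csum0 R); congr csum; apply/funext => n.
  have /eqP := yb n; rewrite mulf_eq0 /e /chain => /orP[] /eqP ->.
    by rewrite !mul0r.
  by rewrite mulr0 conjc0 mulr0 mul0r.
move/eqP; rewrite sub0r oppr_eq0 !mulf_eq0 (negPf yk) (negPf nuk) orbF /=.
by rewrite conjc_eq0 mulf_eq0 invr_eq0 (negPf alpha0) orbF => /eqP.
Qed.

(** If [(y, b) = 0], then [y] lives at the single point where [s n = lambda], and [b]
    vanishes there.  Otherwise [y] is a multiple of [a / (s - lambda)], so its inner
    product with [chain j] is a multiple of the next moment, and orthogonality to the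
    root vectors makes the defects vanish one after the other. *)
Lemma orth_roots_eigenvector_eq0 lambda y : lambda != 0 ->
  orth_compl nu (gen_eigenvector nu Q) y -> P y = lambda *: y -> y = 0.
Proof.
move=> l0 yQ Py; have Ly : L2 nu y by case: yQ.
set kappa := inner nu y b.
have eqn n : (s n - lambda) * y n = - kappa * a n.
  have := congr1 (fun f => f n) Py.
  rewrite perturbed_opE -/kappa -[(lambda *: y) n]/(lambda * y n) => E.
  by rewrite mulrBl -E; ring.
have [k0|k0] := eqVneq kappa 0.
  apply: orth_roots_eq0_of_mul => // n; have [sn|sn] := eqVneq (s n) lambda; last first.
    have /eqP := eqn n; rewrite k0 oppr0 mul0r mulf_eq0 subr_eq0 (negPf sn) /=.
    by move/eqP ->; rewrite mul0r.
  have yE : y = single n (y n).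
    apply/funext => m; rewrite /single; case: eqP => [->//|/eqP mn].
    have /eqP := eqn m; rewrite k0 oppr0 mul0r mulf_eq0 subr_eq0 -sn.
    by rewrite (inj_eq s_inj) (negPf mn) => /eqP.
  move: k0; rewrite /kappa yE inner_singlel => /eqP.
  rewrite !mulf_eq0 -[(nu n)%:C == 0]/((nu n)%:C == 0%:C) (inj_eq (@complexI R)).
  rewrite (gt_eqF (nu_gt0 n)) orbF conjc_eq0 /single eqxx.
  by case/orP => /eqP ->; rewrite ?mul0r ?mulr0.
have sl n : s n != lambda.
  apply/eqP => sn; have /eqP := eqn n.
  by rewrite sn subrr mul0r eq_sym mulf_eq0 oppr_eq0 (negPf k0) (negPf (a_neq0 n)).
have mu0 : conjc lambda != 0 by rewrite conjc_eq0.
have sm n : sbar n != conjc lambda by rewrite (inj_eq (can_inj (@conjcK R))).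
exfalso; apply: (@chain_contra _ _ nu_gt0 sbar a b _ _ _ _ _ (conjc lambda)) => //.
  by move=> n snl; have := sm n; rewrite snl eqxx.
move=> j root_j.
have Le i : L2 nu (chain sbar b (conjc lambda) i) by exact: L2_chain.
have yE i : inner nu y (chain sbar b (conjc lambda) i) =
    - kappa * conjc (inner nu (chain sbar b (conjc lambda) i.+1) a).
  rewrite inner_conj// /inner -csumZ; last exact: asummable_inner.
  congr csum; apply/funext => n; rewrite mulrA mulrA -eqn /chain exprS.
  rewrite !conjcM [conjc (resolvent _ _ _)]conjc_inv /resolvent.
  rewrite conjcD conjcN !conjcK; field.
  by rewrite subr_eq0.
rewrite /chain_defect; case: j root_j => [_|j root_j] /=.
  have := yE 0; rewrite chain0 -/kappa => /eqP.
  rewrite -subr_eq0 mulNr opprK -[X in X + _]mulr1 -mulrDr mulf_eq0 (negPf k0) orFb.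
  by rewrite -conjc_eq0 conjcD conjc1 conjcK addrC => /eqP.
have := yE j.+1; rewrite (orth_root_vector yQ root_j) => /esym/eqP.
by rewrite mulf_eq0 oppr_eq0 (negPf k0) orFb conjc_eq0 addr0 => /eqP.
Qed.

End OrthogonalToRoots.

(** * Finite-dimensional spaces of sequences *)

Section FiniteBasis.
Variables (K : fieldType) (V : lmodType K).

Definition subspace (M : set V) :=
  M 0 /\ forall c x y, M x -> M y -> M (c *: x + y).

Lemma subspace_sum (M : set V) k (c : 'I_k -> K) (v : 'I_k -> V) : subspace M ->
  (forall i, M (v i)) -> M (\sum_(i < k) c i *: v i).
Proof.
by move=> [M0 MD] Mv; elim/big_rec: _ => // i x _ Mx; exact: MD.
Qed.

Definition independent k (v : 'I_k -> V) :=
  forall c : 'I_k -> K, \sum_(i < k) c i *: v i = 0 -> forall i, c i = 0.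

Lemma independent_bound (M : set V) (N : nat) (phi : 'I_N -> V -> K) k (v : 'I_k -> V) :
  subspace M ->
  (forall j c x y, M x -> M y -> phi j (c *: x + y) = c * phi j x + phi j y) ->
  (forall x, M x -> (forall j, phi j x = 0) -> x = 0) ->
  (forall i, M (v i)) -> independent v -> (k <= N)%N.
Proof.
move=> Msub phi_lin phi_inj Mv v_ind.
have phi0 j : phi j 0 = 0.
  have [M0 _] := Msub; have := phi_lin j 1 0 0 M0 M0.
  rewrite scale1r addr0 mul1r => /eqP.
  by rewrite -subr_eq0 opprD addrA subrr sub0r oppr_eq0 => /eqP.
have phi_sum j (c : 'I_k -> K) :
    phi j (\sum_(i < k) c i *: v i) = \sum_(i < k) c i * phi j (v i).
  suff : M (\sum_(i < k) c i *: v i) /\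
    phi j (\sum_(i < k) c i *: v i) = \sum_(i < k) c i * phi j (v i) by case.
  elim/big_rec2: _ => [|i z x _ [Mx <-]]; first by case: Msub.
  by rewrite phi_lin//; split=> //; case: Msub => _; apply.
pose A : 'M[K]_(k, N) := \matrix_(i, j) phi j (v i).
suff /eqP <- : row_free A by exact: rank_leq_col.
apply: inj_row_free => u uA; apply/rowP => i; rewrite mxE.
apply: (v_ind (fun i => u 0 i)); apply: phi_inj; first exact: subspace_sum.
move=> j; rewrite phi_sum.
have := congr1 (fun B : 'rV_N => B 0 j) uA; rewrite !mxE => uAj.
by rewrite -[RHS]uAj; apply: eq_bigr => l _; rewrite mxE.
Qed.

(** The basis is an independent family of maximal length. *)
Lemma finite_basis (M : set V) (N : nat) (phi : 'I_N -> V -> K) :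
  subspace M ->
  (forall j c x y, M x -> M y -> phi j (c *: x + y) = c * phi j x + phi j y) ->
  (forall x, M x -> (forall j, phi j x = 0) -> x = 0) ->
  exists k (e : 'I_k -> V), [/\ (k <= N)%N, forall i, M (e i), independent e &
    forall x, M x -> exists c : 'I_k -> K, x = \sum_(i < k) c i *: e i].
Proof.
move=> Msub phi_lin phi_inj.
pose p k := `[< exists e : 'I_k -> V, (forall i, M (e i)) /\ independent e >].
have p0 : exists k, p k.
  by exists 0%N; apply/asboolP; exists (fun=> 0); split=> [[]|c _ []].
have pN k : p k -> (k <= N)%N.
  by move=> /asboolP[e [Me e_ind]]; exact: (independent_bound Msub phi_lin phi_inj Me).
case: (ex_maxnP p0 pN) => k pk kmax.
have kN := pN _ pk; move/asboolP: pk => [e [Me e_ind]].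
exists k, e; split=> // x Mx; apply: contrapT => x_notin.
suff /kmax : p k.+1 by rewrite ltnn.
(* A vector outside the span of [e] extends [e] to a longer independent family. *)
apply/asboolP; exists (fun i => if unlift ord0 i is Some j then e j else x).
split=> [i|c]; first by case: unliftP.
rewrite big_ord_recl unlift_none => cE.
have cE' : c ord0 *: x + \sum_(i < k) c (lift ord0 i) *: e i = 0.
  by rewrite -[RHS]cE; congr (_ + _); apply: eq_bigr => i _; rewrite liftK.
have [c0|c0] := eqVneq (c ord0) 0; last first.
  case: x_notin; exists (fun i => - (c ord0)^-1 * c (lift ord0 i)).
  apply: (scalerI c0); move/eqP: cE'; rewrite addr_eq0 => /eqP ->.
  rewrite scaler_sumr -sumrN; apply: eq_bigr => i _.
  by rewrite scalerA mulrA mulrN mulfV// mulN1r scaleNr.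
move: cE'; rewrite c0 scale0r add0r => /(e_ind (fun i => c (lift ord0 i))) cl i.
by case: (unliftP ord0 i) => [j ->|->].
Qed.

End FiniteBasis.

Lemma dim_le_span (R : realType) (M : set (nat -> R[i]%C)) k N (e : 'I_k -> nat -> R[i]%C) :
  subspace M -> (k <= N)%N -> (forall i, M (e i)) ->
  (forall x, M x -> exists c : 'I_k -> R[i]%C, x = \sum_(i < k) c i *: e i) ->
  dim_le M N.
Proof.
move=> Msub kN Me Mspan.
(* The family [e] is continued by zero vectors up to length [N]. *)
pose E n : nat -> R[i]%C := if insub n is Some i then e i else 0.
have EE (i : 'I_k) : E i = e i by rewrite /E valK.
exists (fun i : 'I_N => E i); apply/seteqP; split=> x; last first.
  move=> [c ->]; apply: subspace_sum => // i; rewrite /E.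
  by case: insubP => // _; case: Msub.
move=> /Mspan[c ->]; pose C n : R[i]%C := if insub n is Some i then c i else 0.
exists (fun i : 'I_N => C i).
rewrite (eq_bigr (fun i : 'I_k => C i *: E i)); last first.
  by move=> i _; rewrite EE /C valK.
rewrite (big_ord_widen N (fun n => C n *: E n))// big_mkcond/=.
apply: eq_bigr => i _; case: ifP => // ik.
by rewrite /C insubN ?ik// scale0r.
Qed.

Lemma subspace_orth_compl (R : realType) (nu : nat -> R) (S : set (nat -> R[i]%C)) :
  (forall n, 0 < nu n) -> S `<=` L2 nu -> subspace (orth_compl nu S).
Proof.
move=> nu_gt0 SL; split.
  by split; [exact: L2_0|move=> y _; exact: inner0l].
move=> c x y [Lx xS] [Ly yS].
have Lcx : L2 nu (c *: x) by exact: L2Z.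
split; first exact: L2D.
move=> z Sz; have Lz := SL _ Sz.
by rewrite innerDl// innerZl// xS// yS// mulr0 addr0.
Qed.

(** A left eigenvector of the matrix of [T] in the basis [e] gives the coordinates. *)
Lemma invariant_eigenvector (R : realType) (M : set (nat -> R[i]%C))
    (T : (nat -> R[i]%C) -> nat -> R[i]%C) k (e : 'I_k -> nat -> R[i]%C) :
  (0 < k)%N -> independent e -> (forall i, M (e i)) -> subspace M ->
  (forall x, M x -> exists c : 'I_k -> R[i]%C, x = \sum_(i < k) c i *: e i) ->
  (forall x, M x -> M (T x)) ->
  (forall c : 'I_k -> R[i]%C, T (\sum_(i < k) c i *: e i) = \sum_(i < k) c i *: T (e i)) ->
  exists lambda y, [/\ M y, y <> 0 & T y = lambda *: y].
Proof.
move=> k0 e_ind Me Msub Mspan MT T_lin.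
have [A TE] := choice (fun i => Mspan _ (MT _ (Me i))).
have [lambda /eigenvalueP[v vA v0]] :=
  eigenvalue_closed (\matrix_(i, j) A i j : 'M[R[i]%C]_k) k0.
exists lambda, (\sum_(i < k) v 0 i *: e i); split; first exact: subspace_sum.
  move/e_ind => v_eq0; move/eqP: v0; apply; apply/rowP => i.
  by rewrite v_eq0 mxE.
rewrite T_lin; under eq_bigr do rewrite TE scaler_sumr.
rewrite exchange_big scaler_sumr; apply: eq_bigr => j _.
rewrite scalerA; have := congr1 (fun B : 'rV_k => B 0 j) vA; rewrite !mxE => <-.
by rewrite scaler_suml; apply: eq_bigr => i _; rewrite mxE scalerA.
Qed.

(** * Completeness of the adjoint *)

Theorem theorem2p2 (R : realType) (s : nat -> R[i]%C) (nu : nat -> R)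
    (a b : nat -> R[i]%C) (Lstar : (nat -> R[i]%C) -> (nat -> R[i]%C)) (N : nat)
    (s_inj : injective s) (s_neq0 : forall n, s n != 0)
    (s_cvg0 : Normc.normc (s n) @[n --> \oo] --> (0 : R))
    (nu_gt0 : forall n, 0 < nu n) (nu_fin : cvgn (series nu))
    (a_L2 : L2 nu a) (b_L2 : L2 nu b) (a_neq0 : forall n, a n != 0)
    (Lstar_adj : is_adjoint nu (perturbed_op nu s a b) Lstar)
    (L_complete : complete_op nu (perturbed_op nu s a b))
    (ab_sum : cvgn (series (fun n =>
       Normc.normc (b n) ^+ 2 /
       (Normc.normc (a n) ^+ 2 * Normc.normc (s n)^-1 ^+ (2 * N))))) :
  dim_le (orth_compl nu (root_space nu Lstar)) N /\
  (~ (mul_op s @` L2 nu) a -> complete_op nu Lstar).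
Proof.
have bs : bounded_seq s by exact: bounded_seq_cvg0.
have bsb : bounded_seq (conj_seq s) by exact: bounded_seq_conj.
pose P := perturbed_op nu s a b.
pose Q := perturbed_op nu (conj_seq s) b a.
have LstarE := @adjoint_perturbedE R nu s a b Lstar nu_gt0 bs a_L2 b_L2 Lstar_adj.
rewrite -/Q in LstarE.
have QL : gen_eigenvector nu Q `<=` L2 nu by exact: gen_eigenvector_L2.
have genE : gen_eigenvector nu Lstar = gen_eigenvector nu Q.
  have iterE m lambda x : L2 nu x ->
      iter m (spectral_shift Lstar lambda) x = iter m (spectral_shift Q lambda) x.
    move=> Lx; elim: m => //= m ->; rewrite {1}/spectral_shift LstarE//.
    exact: L2_iter_shift.
  by apply/seteqP; split=> x [Lx [lambda [m xm]]]; split=> //; exists lambda, m;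
    [rewrite -[LHS](iterE m lambda)|rewrite [LHS](iterE m lambda)].
set M := orth_compl nu (root_space nu Lstar).
have ME : M = orth_compl nu (gen_eigenvector nu Q).
  by rewrite /M /root_space genE orth_compl_closed_lin_span.
have Msub : subspace M by rewrite ME; exact: subspace_orth_compl.
pose phi (j : 'I_N) y := inner nu y (fun n => conj_seq s n ^+ j * b n).
have Lsb j : L2 nu (fun n => conj_seq s n ^+ j * b n).
  by apply: L2_bounded => //; exact: bounded_seqX.
have ML y : M y -> L2 nu y by case.
have phi_lin j c x y : M x -> M y -> phi j (c *: x + y) = c * phi j x + phi j y.
  move=> /ML Lx /ML Ly; have Lcx : L2 nu (c *: x) by exact: L2Z.
  by rewrite /phi innerDl// innerZl.
have phi_inj y : M y -> (forall j, phi j y = 0) -> y = 0.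
  rewrite ME => My phi0; apply: (@orth_roots_eq0_of_mul R nu nu_gt0 s a b) => //.
  apply: (@orth_roots_annihilates R nu nu_gt0 s a b _ _ _ _ N) => // j jN.
  exact: (phi0 (Ordinal jN)).
have [k [e [kN Me e_ind Mspan]]] := finite_basis Msub phi_lin phi_inj.
split; first exact: dim_le_span Me Mspan.
move=> a_notin; rewrite /complete_op /root_space genE.
apply: closed_lin_span_full => //; rewrite -ME => z Mz.
apply: contrapT => z0.
have k0 : (0 < k)%N.
  rewrite lt0n; apply/eqP => k0; apply: z0; have [c ->] := Mspan _ Mz.
  by rewrite big1// => i; have := ltn_ord i; rewrite {2}k0.
have MP y : M y -> M (P y).
  rewrite ME => -[Ly Qy]; have LPy : L2 nu (P y) by exact: L2_perturbed.
  split=> // g Qg; have Lg := QL _ Qg.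
  have [_ ->//] := Lstar_adj; rewrite LstarE// Qy//.
  exact: gen_eigenvector_perturbed.
have [|lambda [y [My y0 Py]]] := invariant_eigenvector k0 e_ind Me Msub Mspan MP.
  by move=> c; apply: perturbed_sum => // i; apply: ML.
have Ly := ML _ My.
have [l0|l0] := eqVneq lambda 0; last first.
  apply: y0; rewrite ME in My.
  exact: (@orth_roots_eigenvector_eq0 R nu nu_gt0 s a b _ _ _ _ _ _ lambda).
have sy n : s n * y n = - inner nu y b * a n.
  have := congr1 (fun f => f n) Py; rewrite /P perturbed_opE l0 scale0r => /eqP.
  by rewrite addr_eq0 mulNr => /eqP.
have [kap0|kap0] := eqVneq (inner nu y b) 0.
  apply: y0; apply/funext => n; have := sy n; rewrite kap0 oppr0 mul0r => /eqP.
  by rewrite mulf_eq0 (negPf (s_neq0 n)) => /eqP.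
apply: a_notin; exists (- (inner nu y b)^-1 *: y); first exact: L2Z.
apply/funext => n; rewrite /mul_op.
rewrite -[(_ *: y) n]/(- (inner nu y b)^-1 * y n) mulrCA sy.
by rewrite mulrA mulrNN mulVf// mul1r.
Qed.
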